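(* Let $p$ be a prime, $k\ge 1$ and $m\ge 1$ integers, and $n=p^k$. Let $F$ be a $C_m$ field and let $\alpha\in K_2^M(F)/nK_2^M(F)$. Then $\alpha$ can be written as the sum of at most $k(p^{m-1}-1)$ symbols.
   Context: A field $F$ is called $C_m$ if every homogeneous polynomial equation $f(x_1,\dots,x_N)=0$ over $F$ of degree $d\geq 1$ with $N>d^m$ has a non-trivial solution in $F$. $K_2^M(F)$ is the second Milnor $K$-group: the quotient of $F^\times\otimes_{\mathbb{Z}}F^\times$ by the subgroup generated by the elements $a\otimes(1-a)$, $a\in F\setminus\{0,1\}$, written additively. A symbol in $K_2^M(F)/nK_2^M(F)$ is the class $\{a,b\}$ of $a\otimes b$ for some $a,b\in F^\times$. No roots of unity are assumed to lie in $F$. An empty sum is $0$. *)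

(* Defs.v *)
From HB Require Import structures.
From mathcomp Require Import all_boot all_order all_algebra.
From mathcomp Require Import boolp.
From mathcomp Require Import mpoly freeg.

Set Implicit Arguments.
Unset Strict Implicit.
Unset Printing Implicit Defensive.

Import GRing.Theory.
Local Open Scope ring_scope.

(* The zero polynomial is [d.-homog] in multinomials; this is harmless, since
   it has a non-trivial zero as soon as there is a variable, and
   [d ^ m < N] forces [0 < N]. *)
Definition C_field (m : nat) (F : fieldType) : Prop :=
  forall (d N : nat) (f : {mpoly F[N]}),
    (1 <= d)%N -> (d ^ m < N)%N -> f \is d.-homog ->
    exists2 v : 'I_N -> F, (exists i, v i != 0) & f.@[v] = 0.

Section GeneratedSubgroup.
Context (V : zmodType) (A : V -> Prop).

Definition gen_subgroup : {pred V} :=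
  fun x => `[< forall H : zmodClosed V, (forall a, A a -> a \in H) -> x \in H >].

Fact gen_subgroup_zmod_closed : zmod_closed gen_subgroup.
Proof.
split; first by apply/asboolP => H _; exact: rpred0.
move=> x y /asboolP Hx /asboolP Hy; apply/asboolP => H AH.
by rewrite rpredB ?Hx ?Hy.
Qed.

HB.instance Definition _ :=
  GRing.isZmodClosed.Build V gen_subgroup gen_subgroup_zmod_closed.
End GeneratedSubgroup.

Section Multiples.
Context (V : zmodType) (n : nat).

Definition multiples : {pred V} := fun x => `[< exists y : V, x = y *+ n >].

Fact multiples_zmod_closed : zmod_closed multiples.
Proof.
split; first by apply/asboolP; exists 0; rewrite mul0rn.
move=> _ _ /asboolP[x ->] /asboolP[y ->]; apply/asboolP.
by exists (x - y); rewrite mulrnBl.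
Qed.

HB.instance Definition _ :=
  GRing.isZmodClosed.Build V multiples multiples_zmod_closed.
End Multiples.

Section Tensor.
Context (A B : zmodType).

Variant bilinear_relator : {freeg (A * B)} -> Prop :=
| BilinearL (a a' : A) (b : B) :
    bilinear_relator (<< (a + a', b) >> - << (a, b) >> - << (a', b) >>)
| BilinearR (a : A) (b b' : B) :
    bilinear_relator (<< (a, b + b') >> - << (a, b) >> - << (a, b') >>).

Definition tensor := Quotient.quot (gen_subgroup bilinear_relator).

Definition tens (a : A) (b : B) : tensor :=
  \pi_(Quotient.quot (gen_subgroup bilinear_relator))%qT
    (<< (a, b) >> : {freeg (A * B)}).
End Tensor.

(* As [tensor] takes [zmodType]s, the group structure on [Funits F] is written
   additively: [a + b] is the product of [a] and [b], [0] is [1 : F] and [- a]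
   is the inverse of [a]. *)
Definition Funits (F : fieldType) := {x : F | x != 0}.

Section Funits.
Context (F : fieldType).

HB.instance Definition _ := [isSub of Funits F for @sval F (fun x => x != 0)].
HB.instance Definition _ := [Choice of Funits F by <:].

Fact Funits_mul_subproof (a b : Funits F) : val a * val b != 0.
Proof. by rewrite mulf_neq0 ?(valP a) ?(valP b). Qed.

Fact Funits_inv_subproof (a : Funits F) : (val a)^-1 != 0.
Proof. by rewrite invr_eq0 (valP a). Qed.

Definition Funits_one : Funits F := Sub 1 (oner_neq0 F).
Definition Funits_mul (a b : Funits F) : Funits F :=
  Sub (val a * val b) (Funits_mul_subproof a b).
Definition Funits_inv (a : Funits F) : Funits F :=
  Sub (val a)^-1 (Funits_inv_subproof a).

Fact Funits_mulA : associative Funits_mul.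
Proof. by move=> a b c; apply: val_inj; rewrite !SubK mulrA. Qed.

Fact Funits_mulC : commutative Funits_mul.
Proof. by move=> a b; apply: val_inj; rewrite !SubK mulrC. Qed.

Fact Funits_mul1 : left_id Funits_one Funits_mul.
Proof. by move=> a; apply: val_inj; rewrite !SubK mul1r. Qed.

Fact Funits_mulV : left_inverse Funits_one Funits_inv Funits_mul.
Proof. by move=> a; apply: val_inj; rewrite !SubK mulVf ?(valP a). Qed.

HB.instance Definition _ := GRing.isZmodule.Build (Funits F)
  Funits_mulA Funits_mulC Funits_mul1 Funits_mulV.
End Funits.

Section MilnorK2.
Context (F : fieldType).

(* For [a b : Funits F], [val b = 1 - val a] forces [val a] to be different
   from [0] and [1]. *)
Variant steinberg_relator : tensor (Funits F) (Funits F) -> Prop :=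
| Steinberg (a b : Funits F) of val b = 1 - val a :
    steinberg_relator (tens a b).

Definition milnorK2 := Quotient.quot (gen_subgroup steinberg_relator).

Definition milnorK2_class (t : tensor (Funits F) (Funits F)) : milnorK2 :=
  \pi_(Quotient.quot (gen_subgroup steinberg_relator))%qT t.

Definition milnorK2_mod (n : nat) := Quotient.quot (@multiples milnorK2 n).

Definition symbol (n : nat) (a b : Funits F) : milnorK2_mod n :=
  \pi_(Quotient.quot (@multiples milnorK2 n))%qT (milnorK2_class (tens a b)).
End MilnorK2.

Definition is_symbol (F : fieldType) (n : nat) (x : milnorK2_mod F n) : Prop :=
  exists a b : Funits F, x = symbol n a b.

(* Main.v *)
Require Import Defs.
From HB Require Import structures.
From mathcomp Require Import all_boot all_order all_algebra all_field.
From mathcomp Require Import boolp.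
From mathcomp Require Import mpoly freeg.

(* Peeling off multiples of [p] one at a time, [p {a, b} = {a ^ p, b}] reduces
   to [k = 1]: modulo [p], a sum of [r = p ^ (m - 1)] symbols [{a_i, b_i}] must
   be a sum of [r - 1] symbols.  Let [N_i] be the norm form, in [p] variables,
   of [F[theta] / (theta ^ p - a_i)].  The form
     [a_1 (a_2 (... (a_r c ^ p + b_r N_r) ...) + b_2 N_2) + b_1 N_1]
   of degree [p] in [p r + 1 = p ^ m + 1] variables has a non-trivial zero.  As
   [{a, b} = {a, b N}] for a norm [N], a value [z <> 0] of the inner form lets
   the symbols inside be rewritten with [z] as an entry of one of them, and the
   vanishing of the whole form makes one symbol disappear.

   That [{a, N}] is divisible by [p] is shown without transfer maps: [N] is the
   value at [t = a] of a polynomial [N_t], and the residues of [{t, N_t}] are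
   [p]-th powers, so that modulo [p] this element of [K_2(F(t))] comes from
   [K_2(F)] by the Milnor-Tate filtration by degree; specializing at [t = 1]
   shows that it vanishes. *)

Set Implicit Arguments.
Unset Strict Implicit.
Unset Printing Implicit Defensive.

Import GRing.Theory.
Local Open Scope ring_scope.

(** * Symbols *)

Section QuotientFacts.
Context (V : zmodType) (S : zmodClosed V).

Lemma quot_pi_eq0 (x : V) : x \in S ->
  \pi_(Quotient.quot S)%qT x = 0 :> Quotient.quot S.
Proof.
move=> xS; rewrite -[RHS](raddf0 (\pi_(Quotient.quot S)%qT)).
by apply/eqP; rewrite -Quotient.idealrBE subr0.
Qed.

Lemma quot_pi_eq0P (x : V) :
  reflect (\pi_(Quotient.quot S)%qT x = 0 :> Quotient.quot S) (x \in S).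
Proof.
apply: (iffP idP) => [|x0]; first exact: quot_pi_eq0.
by rewrite -[x]subr0 Quotient.idealrBE raddf0 x0.
Qed.

End QuotientFacts.

Lemma gen_subgroupW (V : zmodType) (A : V -> Prop) (x : V) :
  A x -> x \in gen_subgroup A.
Proof. by move=> Ax; apply/asboolP => H; apply. Qed.

Lemma multiplesP (V : zmodType) (n : nat) (x : V) :
  reflect (exists y, x = y *+ n) (x \in multiples n).
Proof. exact: asboolP. Qed.

Section K2.
Context (F : fieldType).
Implicit Types a b c : Funits F.

Lemma Funits_valD a b : val (a + b) = val a * val b.
Proof. by []. Qed.

Lemma Funits_valMn a n : val (a *+ n) = val a ^+ n.
Proof. by elim: n => // n IH; rewrite mulrS exprS Funits_valD IH. Qed.

Lemma tensDl a a' b : tens (a + a') b = tens a b + tens a' b.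
Proof.
apply/eqP; rewrite -subr_eq0 opprD addrA /tens -!raddfB /=; apply/eqP.
by apply: quot_pi_eq0; apply: gen_subgroupW; exact: BilinearL.
Qed.

Lemma tensDr a b b' : tens a (b + b') = tens a b + tens a b'.
Proof.
apply/eqP; rewrite -subr_eq0 opprD addrA /tens -!raddfB /=; apply/eqP.
by apply: quot_pi_eq0; apply: gen_subgroupW; exact: BilinearR.
Qed.

Definition k2 a b : milnorK2 F := milnorK2_class (tens a b).

Lemma k2Dl a a' b : k2 (a + a') b = k2 a b + k2 a' b.
Proof. by rewrite /k2 tensDl /milnorK2_class raddfD. Qed.

Lemma k2Dr a b b' : k2 a (b + b') = k2 a b + k2 a b'.
Proof. by rewrite /k2 tensDr /milnorK2_class raddfD. Qed.

Lemma k2_steinberg a b : val a + val b = 1 -> k2 a b = 0.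
Proof.
move=> ab1; apply: quot_pi_eq0; apply: gen_subgroupW; apply: Steinberg.
by rewrite -ab1 addrC addKr.
Qed.

Lemma k2_0l b : k2 0 b = 0.
Proof. by apply/(addrI (k2 0 b)); rewrite addr0 -k2Dl addr0. Qed.

Lemma k2_Nl a b : k2 (- a) b = - k2 a b.
Proof. by apply/eqP; rewrite -addr_eq0 -k2Dl addNr k2_0l. Qed.

Lemma k2_Mnl a b n : k2 (a *+ n) b = k2 a b *+ n.
Proof. by elim: n => [|n IH]; rewrite ?k2_0l // !mulrS k2Dl IH. Qed.

(** Lifting through both quotients gives an integer combination of pairs; a negative coefficient is
    absorbed by inverting the first entry, so a plain list suffices. *)
Lemma k2_generation (x : milnorK2 F) :
  exists s : seq (Funits F * Funits F), x = \sum_(ab <- s) k2 ab.1 ab.2.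
Proof.
pose G x := exists s : seq (Funits F * Funits F), x = \sum_(ab <- s) k2 ab.1 ab.2.
have G0 : G 0 by exists [::]; rewrite big_nil.
have GD y z : G y -> G z -> G (y + z).
  by move=> [s ->] [t ->]; exists (s ++ t); rewrite big_cat.
have GN y : G y -> G (- y).
  move=> [s ->]; exists [seq (- ab.1, ab.2) | ab <- s].
  by rewrite big_map -sumrN; apply: eq_bigr => ab _; rewrite k2_Nl.
have GM y (n : int) : G y -> G (y *~ n).
  move=> Gy; have Gn k : G (y *+ k) by elim: k => // k IH; rewrite mulrS; exact: GD.
  by case: n => k; [exact: Gn | apply: GN; exact: Gn].
suff: G x by [].
rewrite -[x]reprK -[repr x]reprK -[repr (repr x)]freeg_sumE.
rewrite !raddf_sum /=; elim/big_rec: _ => // z y _ Gy; apply: GD => //.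
rewrite -[coeff _ _]intz -freegU_mulz.
rewrite !raddfMz /=; apply: GM; exists [:: z]; rewrite big_seq1.
by case: z.
Qed.

Section Symbol.
Context (n : nat).
Local Notation "{{ a , b }}" := (symbol n a b) (at level 0).

Lemma symbolE a b : {{a, b}} = \pi_(milnorK2_mod F n)%qT (k2 a b).
Proof. by []. Qed.

Lemma symbolDl a a' b : {{a + a', b}} = {{a, b}} + {{a', b}}.
Proof. by rewrite !symbolE k2Dl raddfD. Qed.

Lemma symbolDr a b b' : {{a, b + b'}} = {{a, b}} + {{a, b'}}.
Proof. by rewrite !symbolE k2Dr raddfD. Qed.

Lemma symbol_steinberg a b : val a + val b = 1 -> {{a, b}} = 0.
Proof. by move=> ab1; rewrite symbolE k2_steinberg // raddf0. Qed.

Lemma milnorK2_mod_torsion (x : milnorK2_mod F n) : x *+ n = 0.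
Proof.
rewrite -[x]reprK -raddfMn /=; apply: quot_pi_eq0; apply/multiplesP.
by exists (repr x).
Qed.

Lemma symbol_generation (x : milnorK2_mod F n) :
  exists s : seq (Funits F * Funits F), x = \sum_(ab <- s) {{ab.1, ab.2}}.
Proof.
have [s xs] := k2_generation (repr x); exists s.
by rewrite -[x]reprK xs raddf_sum.
Qed.

End Symbol.

End K2.

(** * Steinberg symbols *)

(* Reflexive decision of identities that hold in every abelian group. *)
Inductive zexp := ZVar of nat | ZZero | ZAdd of zexp & zexp | ZOpp of zexp.

Fixpoint zeval (B : zmodType) (env : seq B) e : B :=
  match e with
  | ZVar i => env`_i
  | ZZero => 0
  | ZAdd e1 e2 => zeval env e1 + zeval env e2
  | ZOpp e1 => - zeval env e1
  end.

(** Positive and negative occurrences are counted apart, in [nat], so that equality of coefficients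
    is settled by computation. *)
Fixpoint zcoef e (i : nat) : nat * nat :=
  match e with
  | ZVar j => ((j == i : nat), 0)%N
  | ZZero => (0, 0)%N
  | ZAdd e1 e2 =>
      ((zcoef e1 i).1 + (zcoef e2 i).1, (zcoef e1 i).2 + (zcoef e2 i).2)%N
  | ZOpp e1 => ((zcoef e1 i).2, (zcoef e1 i).1)
  end.

Lemma zevalE (B : zmodType) (env : seq B) e :
  zeval env e =
  \sum_(i < size env) (env`_i *+ (zcoef e i).1 - env`_i *+ (zcoef e i).2).
Proof.
elim: e => [j||e1 IH1 e2 IH2|e IH] /=.
- have [lt_j|ge_j] := ltnP j (size env).
    rewrite (bigD1 (Ordinal lt_j)) //= eqxx mulr1n mulr0n subr0 big1 ?addr0 //.
    move=> i; rewrite -val_eqE /= eq_sym => /negPf ->.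
    by rewrite !mulr0n subr0.
  rewrite nth_default // big1 // => i _.
  by rewrite eq_sym (ltn_eqF (leq_trans (ltn_ord i) ge_j)) !mulr0n subr0.
- by rewrite big1 // => i _; rewrite !mulr0n subr0.
- rewrite IH1 IH2 -big_split; apply: eq_bigr => i _ /=.
  by rewrite !mulrnDr opprD addrACA.
- by rewrite IH -sumrN; apply: eq_bigr => i _; rewrite opprB.
Qed.

Lemma zeval_eq (B : zmodType) (env : seq B) e1 e2 :
  all (fun i => ((zcoef e1 i).1 + (zcoef e2 i).2 ==
                 (zcoef e2 i).1 + (zcoef e1 i).2)%N) (iota 0 (size env)) ->
  zeval env e1 = zeval env e2.
Proof.
move=> /allP eq12; rewrite !zevalE; apply: eq_bigr => i _.
have /eq12/eqP eqi : (i : nat) \in iota 0 (size env) by rewrite mem_iota /=.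
apply/eqP; rewrite subr_eq addrAC eq_sym subr_eq -!mulrnDr; apply/eqP.
by rewrite eqi.
Qed.

Ltac zmod_index x env :=
  match env with
  | ?y :: _ => let _ := match goal with _ => unify x y end in constr:(0%N)
  | _ :: ?env' => let n := zmod_index x env' in constr:(n.+1)
  end.

Ltac zmod_env env t :=
  match t with
  | (?a + ?b)%R => let env1 := zmod_env env a in zmod_env env1 b
  | (- ?a)%R => zmod_env env a
  | 0%R => env
  | ?x => match env with
          | context [x :: _] => env
          | _ => let _ := zmod_index x env in env
          | _ => constr:(x :: env)
          end
  end.

Ltac zmod_quote env t :=
  match t with
  | (?a + ?b)%R => let x := zmod_quote env a in let y := zmod_quote env b in
                   constr:(ZAdd x y)
  | (- ?a)%R => let x := zmod_quote env a in constr:(ZOpp x)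
  | 0%R => constr:(ZZero)
  | ?x => let n := zmod_index x env in constr:(ZVar n)
  end.

Ltac zmod :=
  match goal with
  | |- @eq ?B ?l ?r =>
      let env0 := zmod_env (@nil B) l in
      let env := zmod_env env0 r in
      let e1 := zmod_quote env l in
      let e2 := zmod_quote env r in
      exact: (@zeval_eq _ env e1 e2 isT)
  end.

(** Reduces a goal to a known relation [c = d]; the remaining formal identity is left to [zmod]. *)
Lemma zmod_lin (B : zmodType) (a b c d : B) : c = d -> a - b = c - d -> a = b.
Proof. by move=> -> /eqP; rewrite subrr subr_eq0 => /eqP. Qed.

Lemma zmod_lin2 (B : zmodType) (a b c d : B) :
  c = 0 -> d = 0 -> a - b + d = c -> a = b.
Proof. by move=> -> ->; rewrite addr0 => /eqP; rewrite subr_eq0 => /eqP. Qed.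

Section Steinberg.
Context (F : fieldType) (B : zmodType).

Definition funit (x : F) (x0 : x != 0) : Funits F := Sub x x0.

(** Negation in the field: the group law being multiplication, [- a] already denotes the inverse. In
    particular [foppr 0] is the unit $-1$. *)
Definition foppr (a : Funits F) : Funits F :=
  Sub (- val a) (etrans (congr1 negb (oppr_eq0 (val a))) (valP a)).

(** The target [B] is arbitrary, so that the calculations do not depend on how $K_2$ is built as a
    quotient. *)
Record steinberg_symbol (s : Funits F -> Funits F -> B) : Prop :=
  SteinbergSymbol {
    st_Dl a a' b : s (a + a') b = s a b + s a' b;
    st_Dr a b b' : s a (b + b') = s a b + s a b';
    st_steinberg a b : val a + val b = 1 -> s a b = 0 }.

Context (s : Funits F -> Funits F -> B) (sP : steinberg_symbol s).
Implicit Types a b c : Funits F.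

Lemma fopprE a : foppr a = foppr 0 + a.
Proof. by apply: val_inj; rewrite /= mulN1r. Qed.

Lemma fopprK : involutive foppr.
Proof. by move=> a; apply: val_inj; rewrite /= opprK. Qed.

Lemma foppr0D0 : foppr 0 + foppr 0 = 0.
Proof. by rewrite -fopprE fopprK. Qed.

Lemma st_0l b : s 0 b = 0.
Proof. by apply/(addrI (s 0 b)); rewrite addr0 -(st_Dl sP) addr0. Qed.

Lemma st_0r b : s b 0 = 0.
Proof. by apply/(addrI (s b 0)); rewrite addr0 -(st_Dr sP) addr0. Qed.

Lemma st_Nl a b : s (- a) b = - s a b.
Proof. by apply/eqP; rewrite -addr_eq0 -(st_Dl sP) addNr st_0l. Qed.

Lemma st_Nr a b : s a (- b) = - s a b.
Proof. by apply/eqP; rewrite -addr_eq0 -(st_Dr sP) addNr st_0r. Qed.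

Lemma st_Mnl a b n : s (a *+ n) b = s a b *+ n.
Proof. by elim: n => [|n IH]; rewrite ?st_0l // !mulrS (st_Dl sP) IH. Qed.

(* [- a = (1 - a) / (1 - a^-1)] for [a != 1]. *)
Lemma st_foppr a : s a (foppr a) = 0.
Proof.
have [a1|a_neq1] := eqVneq (val a) 1.
  by have -> : a = 0; [exact: val_inj | rewrite st_0l].
have b_neq0 : 1 - val a != 0 by rewrite subr_eq0 eq_sym.
have c_neq0 : 1 - (val a)^-1 != 0.
  by rewrite subr_eq0 eq_sym invr_eq1.
pose b : Funits F := Sub (1 - val a) b_neq0.
pose c : Funits F := Sub (1 - (val a)^-1) c_neq0.
have -> : foppr a = b - c.
  apply: val_inj => /=; apply: (mulIf c_neq0); rewrite divfK //.
  by rewrite mulrBr mulr1 mulNr divff ?(valP a) // opprK addrC.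
rewrite (st_Dr sP) st_Nr (st_steinberg sP) ?sub0r; last by rewrite /= addrC subrK.
by rewrite -st_Nl (st_steinberg sP) //= addrC subrK.
Qed.

(** Expand $\{ab, -ab\} = 0$ and cancel $\{a, -a\}$ and $\{b, -b\}$. *)
Lemma st_anti a b : s a b = - s b a.
Proof.
have := st_foppr (a + b); rewrite fopprE addrCA -fopprE.
have := st_foppr a; have := st_foppr b.
rewrite !(fopprE b) !(fopprE a) !(st_Dl sP) !(st_Dr sP) => E1 E2 E3.
have E12 := etrans (congr2 +%R E1 E2) (addr0 0).
apply: (zmod_lin2 E3 E12); zmod.
Qed.

(** $\{a, -a\} = 0$ gives $\{a, a\} = -\{a, -1\}$, and $\{a, -1\}$ is killed by $2$. *)
Lemma st_diag a : s a a = s a (foppr 0).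
Proof.
have := st_foppr a; rewrite fopprE (st_Dr sP) => E.
have E2 : s a (foppr 0) + s a (foppr 0) = 0.
  by rewrite -(st_Dr sP) foppr0D0 st_0r.
apply: (zmod_lin2 E E2); zmod.
Qed.

(* The Steinberg relation for [a / c + b / c = 1]. *)
Lemma st_add a b c : val a + val b = val c -> s a b - s a c - s c b + s c c = 0.
Proof.
move=> abc; have : s (a - c) (b - c) = 0.
  by apply: (st_steinberg sP); rewrite /= -mulrDl abc divff ?(valP c).
rewrite (st_Dl sP) !(st_Dr sP) !st_Nr !st_Nl => E; apply: (zmod_lin E); zmod.
Qed.

End Steinberg.

(** * Symbols on polynomials *)

(** Stands for a homomorphism from $K_2(F(X))/p$, recorded by its values on nonzero polynomials to
    avoid fractions: [ps_steinberg] is the Steinberg relation for $f/(f+g)$ and $g/(f+g)$, expanded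
    by bilinearity. *)
Record poly_symbol (F : fieldType) (p : nat) (B : zmodType)
    (s : {poly F} -> {poly F} -> B) : Prop := PolySymbol {
  ps_Ml (f g h : {poly F}) : f != 0 -> g != 0 -> h != 0 -> s (f * g) h = s f h + s g h;
  ps_Mr (f g h : {poly F}) : f != 0 -> g != 0 -> h != 0 -> s h (f * g) = s h f + s h g;
  ps_oppr (f : {poly F}) : f != 0 -> s f (- f) = 0;
  ps_steinberg (f g : {poly F}) : f != 0 -> g != 0 -> f + g != 0 ->
    s f g - s f (f + g) - s (f + g) g + s (f + g) (f + g) = 0;
  ps_torsion (x : B) : x *+ p = 0 }.

Section PolySymbolTheory.
Context (F : fieldType) (p : nat) (B : zmodType).
Context (s : {poly F} -> {poly F} -> B) (sP : poly_symbol p s).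
Implicit Types f g h : {poly F}.

Lemma ps_1r f : f != 0 -> s f 1 = 0.
Proof.
move=> f0; apply/(addrI (s f 1)).
by rewrite addr0 -(ps_Mr sP) ?oner_neq0 // mulr1.
Qed.

Lemma ps_Xr f g n : f != 0 -> g != 0 -> s g (f ^+ n) = s g f *+ n.
Proof.
move=> f0 g0; elim: n => [|n IH]; first by rewrite expr0 ps_1r.
by rewrite exprS (ps_Mr sP) ?expf_neq0 // IH mulrS.
Qed.

Let N1_neq0 : -1 != 0 :> {poly F}.
Proof. by rewrite oppr_eq0 oner_neq0. Qed.

Lemma ps_anti f g : f != 0 -> g != 0 -> s f g = - s g f.
Proof.
move=> f0 g0; have fg0 := mulf_neq0 f0 g0.
have := ps_oppr sP fg0; have := ps_oppr sP f0; have := ps_oppr sP g0.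
rewrite -(mulN1r f) -(mulN1r g) -(mulN1r (f * g)) !(ps_Mr sP) ?mulf_neq0 //.
rewrite !(ps_Ml sP) // => E1 E2 E3.
have E12 := etrans (congr2 +%R E1 E2) (addr0 0).
apply: (zmod_lin2 E3 E12); zmod.
Qed.

Lemma ps_diag f : f != 0 -> s f f = s f (- 1).
Proof.
move=> f0; have := ps_oppr sP f0; rewrite -(mulN1r f) (ps_Mr sP) // => E.
have E2 : s f (- 1) + s f (- 1) = 0.
  by rewrite -(ps_Mr sP) // mulrNN mulr1 ps_1r.
apply: (zmod_lin2 E E2); zmod.
Qed.

End PolySymbolTheory.

(* The Steinberg relation is invariant under scaling, so it suffices to check
   it where [P] divides at most one of the three polynomials. *)
Lemma poly_symbol_local (F : fieldType) (p : nat) (B : zmodType)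
    (s : {poly F} -> {poly F} -> B) (P : {poly F}) : (1 < size P)%N ->
    (forall f g h : {poly F}, f != 0 -> g != 0 -> h != 0 ->
      s (f * g) h = s f h + s g h) ->
    (forall f g h : {poly F}, f != 0 -> g != 0 -> h != 0 ->
      s h (f * g) = s h f + s h g) ->
    (forall f : {poly F}, f != 0 -> s f (- f) = 0) ->
    (forall x : B, x *+ p = 0) ->
    (forall f g : {poly F}, f != 0 -> g != 0 -> f + g != 0 ->
      [|| ~~ (P %| f) && ~~ (P %| g), ~~ (P %| f) && ~~ (P %| f + g)
        | ~~ (P %| g) && ~~ (P %| f + g)] ->
      s f g - s f (f + g) - s (f + g) g + s (f + g) (f + g) = 0) ->
  poly_symbol p s.
Proof.
move=> P1 sMl sMr sN sp sS; split=> // f.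
have P0 : P != 0 by rewrite -size_poly_gt0 ltnW.
have [n le_fn] := ubnP (size f); elim: n => // n IH in f le_fn * => g f0 g0 fg0.
have [Pf|Pf] := boolP (P %| f); last first.
  have [Pg|Pg] := boolP (P %| g); last by apply: sS => //; rewrite Pf Pg.
  by apply: sS => //; rewrite Pg dvdp_addl // Pf.
have [Pg|Pg] := boolP (P %| g); last first.
  by apply: sS => //; rewrite Pf dvdp_addr // Pg.
(* Here [P] divides all three polynomials: cancelling it lowers the degree of [f], and bilinearity
   carries the relation back. *)
pose f' : {poly F} := f %/ P; pose g' : {poly F} := g %/ P.
have ef : f = f' * P by rewrite divpK.
have eg : g = g' * P by rewrite divpK.
have efg : f + g = (f' + g') * P by rewrite mulrDl -ef -eg.
move: f0 g0 fg0 le_fn; rewrite efg {}ef {}eg {efg} => {Pf Pg}.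
move: f' g' => f' g' {f g}.
rewrite !mulf_eq0 !(negPf P0) !orbF => f0 g0 fg0 le_fn.
have E : s f' g' - s f' (f' + g') - s (f' + g') g' + s (f' + g') (f' + g') = 0.
  apply: IH => //; move: le_fn; rewrite size_mul //.
  case: (size P) P1 => [|[|m]] // _.
  by rewrite !addnS /= ltnS => /(leq_ltn_trans (leq_addr _ _)).
rewrite !sMl ?mulf_neq0 // !sMr //.
apply: (zmod_lin E); zmod.
Qed.

(** * Valuation and cofactor at an irreducible polynomial *)

Section Valuation.
Context (F : fieldType) (P : {poly F}) (P_irr : irreducible_poly P).
Implicit Types f g : {poly F}.

Let P1 : (1 < size P)%N. Proof. exact: P_irr.1. Qed.
Let P0 : P != 0. Proof. by rewrite -size_poly_gt0 ltnW. Qed.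

Lemma irreducible_dvdpM f g : (P %| f * g) = (P %| f) || (P %| g).
Proof.
apply/idP/orP=> [Pfg|[Pf|Pg]]; [|exact: dvdp_mulr|exact: dvdp_mull].
 have [Pf|Pf] := boolP (P %| f); [by left | right].
have co_Pf : coprimep P f.
  have := dvdp_gcdl P f => /(irredp_XsubCP P_irr)[eq1|eqP].
    by rewrite coprimep_def (eqp_size eq1) size_poly1.
  by case/negP: Pf; rewrite -(eqp_dvdl _ eqP) dvdp_gcdr.
by rewrite -(Gauss_dvdpr _ co_Pf).
Qed.

Lemma exists_cofactor f : f != 0 ->
  exists vu : nat * {poly F}, f = P ^+ vu.1 * vu.2 /\ ~~ (P %| vu.2).
Proof.
have [n le_fn] := ubnP (size f); elim: n => // n IH in f le_fn * => f0.
have [Pf|Pf] := boolP (P %| f); last by exists (0%N, f); rewrite expr0 mul1r.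
move: Pf f0 le_fn => /dvdpP[g ->].
rewrite mulf_eq0 (negPf P0) orbF => g0 le_fn.
have [|[v u] /= [-> Pu]] := IH g _ g0.
  move: le_fn; rewrite size_mul //; case: (size P) P1 => [|[|m]] // _.
  by rewrite !addnS /= ltnS => /(leq_ltn_trans (leq_addr _ _)).
by exists (v.+1, u); rewrite mulrC mulrA -exprS.
Qed.

(** The $P$-adic valuation together with the cofactor prime to $P$; the pair at $f = 0$ is a dummy
    value. *)
Definition val_cofactor f : nat * {poly F} :=
  if pselect (f != 0) is left f0 then projT1 (cid (exists_cofactor f0))
  else (0%N, 1).

Definition pval f : nat := (val_cofactor f).1.
Definition pcof f : {poly F} := (val_cofactor f).2.

Lemma pval_pcofE f : f != 0 -> f = P ^+ pval f * pcof f.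
Proof.
move=> f0; rewrite /pval /pcof /val_cofactor; case: pselect => // f0'.
by case: (projT2 (cid (exists_cofactor f0'))).
Qed.

Lemma pcof_ndvd f : f != 0 -> ~~ (P %| pcof f).
Proof.
move=> f0; rewrite /pcof /val_cofactor; case: pselect => // f0'.
by case: (projT2 (cid (exists_cofactor f0'))).
Qed.

Lemma ndvdp_neq0 f : ~~ (P %| f) -> f != 0.
Proof. by apply: contraNneq => ->; exact: dvdp0. Qed.

Lemma val_cofactor_unique n g : ~~ (P %| g) ->
  val_cofactor (P ^+ n * g) = (n, g).
Proof.
move=> Pg; set f := P ^+ n * g.
have f0 : f != 0 by apply: mulf_neq0; [exact: expf_neq0 | exact: ndvdp_neq0].
have := pval_pcofE f0; have := pcof_ndvd f0.
rewrite /pval /pcof; case: (val_cofactor f) => m h /= Ph; rewrite /f {f f0}.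
have [lt_nm|lt_mn|<-] := ltngtP n m; last first.
- by move/(mulfI (expf_neq0 n P0)) => <-.
- rewrite -(subnKC lt_mn) addSnnS exprD -mulrA.
  move/(mulfI (expf_neq0 m P0)); rewrite exprS -mulrA => hE.
  by rewrite -hE dvdp_mulr in Ph.
- rewrite -(subnKC lt_nm) addSnnS exprD -mulrA.
  move/(mulfI (expf_neq0 n P0)); rewrite exprS -mulrA => gE.
  by rewrite gE dvdp_mulr in Pg.
Qed.

Lemma val_cofactorM f g : f != 0 -> g != 0 ->
  val_cofactor (f * g) = ((pval f + pval g)%N, pcof f * pcof g).
Proof.
move=> f0 g0; rewrite {1}(pval_pcofE f0) {1}(pval_pcofE g0) mulrACA -exprD.
by rewrite val_cofactor_unique // irreducible_dvdpM negb_or !pcof_ndvd.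
Qed.

Lemma pvalM f g : f != 0 -> g != 0 -> pval (f * g) = (pval f + pval g)%N.
Proof. by move=> f0 g0; rewrite {1}/pval val_cofactorM. Qed.

Lemma pcofM f g : f != 0 -> g != 0 -> pcof (f * g) = pcof f * pcof g.
Proof. by move=> f0 g0; rewrite {1}/pcof val_cofactorM. Qed.

Lemma val_cofactor_ndvd f : ~~ (P %| f) -> val_cofactor f = (0%N, f).
Proof. by move=> Pf; rewrite -{1}[f]mul1r -(expr0 P) val_cofactor_unique. Qed.

Lemma pval_ndvd f : ~~ (P %| f) -> pval f = 0%N.
Proof. by move=> Pf; rewrite /pval val_cofactor_ndvd. Qed.

Lemma pcof_ndvd_id f : ~~ (P %| f) -> pcof f = f.
Proof. by move=> Pf; rewrite /pcof val_cofactor_ndvd. Qed.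

Lemma ndvdp1 : ~~ (P %| 1).
Proof. by rewrite dvdp1 neq_ltn P1 orbT. Qed.

Lemma val_cofactor_self : val_cofactor P = (1%N, 1).
Proof.
have -> : val_cofactor P = val_cofactor (P ^+ 1 * 1) by rewrite expr1 mulr1.
exact: (val_cofactor_unique 1 ndvdp1).
Qed.

Lemma val_cofactorN f : f != 0 -> val_cofactor (- f) = (pval f, - pcof f).
Proof.
move=> f0; rewrite {1}(pval_pcofE f0) -mulrN val_cofactor_unique //.
by rewrite dvdpNr pcof_ndvd.
Qed.

End Valuation.

(** * Tame symbols and specialization *)

Section Local.
Context (F : fieldType) (P : {poly F}) (P_irr : irreducible_poly P).
Context (L : fieldType) (ev : {rmorphism {poly F} -> L}).
Hypothesis ev_ker : forall f, (ev f == 0) = (P %| f).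
Implicit Types f g : {poly F}.

(** The residue of $f / P^{v(f)}$. As [L] is any field receiving a morphism with kernel $(P)$, this
    covers both the residue field at [P] and evaluation at a point of [F]. *)
Definition res f : Funits L := insubd (0 : Funits L) (ev (pcof P_irr f)).

Lemma res_val f : f != 0 -> val (res f) = ev (pcof P_irr f).
Proof.
move=> f0; have ev0 : ev (pcof P_irr f) != 0 by rewrite ev_ker pcof_ndvd.
by rewrite /res insubdK.
Qed.

Lemma resM f g : f != 0 -> g != 0 -> res (f * g) = res f + res g.
Proof.
move=> f0 g0; apply: val_inj; rewrite /= !res_val ?mulf_neq0 //.
by rewrite pcofM // rmorphM.
Qed.

Lemma resN f : f != 0 -> res (- f) = foppr (res f).
Proof.
move=> f0; apply: val_inj; rewrite /= !res_val ?oppr_eq0 //.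
by rewrite /pcof val_cofactorN // rmorphN.
Qed.

Lemma pvalN f : f != 0 -> pval P_irr (- f) = pval P_irr f.
Proof. by move=> f0; rewrite {1}/pval val_cofactorN. Qed.

Lemma res_ndvd f : ~~ (P %| f) -> val (res f) = ev f.
Proof. by move=> Pf; rewrite res_val ?(ndvdp_neq0 Pf) // pcof_ndvd_id. Qed.

Lemma res_eq f g : ~~ (P %| f) -> ~~ (P %| g) -> P %| f - g -> res f = res g.
Proof.
move=> Pf Pg; rewrite -ev_ker rmorphB subr_eq0 => /eqP e.
by apply: val_inj; rewrite /= !res_ndvd.
Qed.

(** Case analysis for a Steinberg relation: if [P] divides exactly one of [f], [g], [f + g], the
    residues of the other two are equal or opposite. *)
Let res_steinberg (B : zmodType) (t : {poly F} -> {poly F} -> B) f g :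
  f != 0 -> g != 0 -> f + g != 0 ->
  [|| ~~ (P %| f) && ~~ (P %| g), ~~ (P %| f) && ~~ (P %| f + g)
        | ~~ (P %| g) && ~~ (P %| f + g)] ->
  (~~ (P %| f) -> ~~ (P %| g) -> ~~ (P %| f + g) -> t f g = 0) ->
  (~~ (P %| f) -> ~~ (P %| g) -> res g = foppr (res f) -> t f g = 0) ->
  (~~ (P %| f) -> ~~ (P %| f + g) -> res (f + g) = res f -> t f g = 0) ->
  (~~ (P %| g) -> ~~ (P %| f + g) -> res (f + g) = res g -> t f g = 0) ->
  t f g = 0.
Proof.
move=> f0 g0 fg0 Pfg t0 tfg tf tg.
have [Pf|Pf] := boolP (P %| f).
  move: Pfg; rewrite Pf /= => /andP[Pg Ph]; apply: tg => //.
  by apply: res_eq; rewrite // addrK.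
have [Pg|Pg] := boolP (P %| g).
  move: Pfg; rewrite Pf Pg /= orbF => Ph; apply: tf => //.
  by apply: res_eq; rewrite // addrC addKr.
have [Ph|Ph] := boolP (P %| f + g); last exact: t0.
apply: tfg => //; rewrite -resN //; apply: res_eq; rewrite ?dvdpNr //.
by rewrite opprK addrC.
Qed.

Section Tame.
Context (p : nat) (B : zmodType) (q : {additive Funits L -> B}).
Hypothesis B_torsion : forall x : B, x *+ p = 0.

(** The tame symbol $(-1)^{v(f)v(g)} f^{v(g)} / g^{v(f)}$ modulo $P$, written additively and pushed
    forward along [q]. *)
Definition tame f g : B :=
  q (foppr 0) *+ (pval P_irr f * pval P_irr g)
  + q (res f) *+ pval P_irr g - q (res g) *+ pval P_irr f.

Let qD (x y : Funits L) : q (x + y) = q x + q y.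
Proof. exact: raddfD. Qed.

Let q_N1 : q (foppr 0) + q (foppr 0) = 0.
Proof. by rewrite -raddfD foppr0D0 raddf0. Qed.

(** $n^2$ and $n$ have the same parity, and the image of $-1$ is killed by $2$. *)
Let q_N1_sqr n : q (foppr 0) *+ (n * n) = q (foppr 0) *+ n.
Proof.
have q2 k : q (foppr 0) *+ k.*2 = 0.
  by rewrite -addnn mulrnDr -mulrnDl q_N1 mul0rn.
by rewrite -[in LHS](odd_double_half (n * n)) -[in RHS](odd_double_half n)
  !mulrnDr !q2 oddM andbb.
Qed.

Lemma tame_poly_symbol : poly_symbol p tame.
Proof.
apply: (poly_symbol_local P_irr.1) => //.
- move=> f g h f0 g0 h0; rewrite /tame resM // pvalM // qD mulrnDl.
  by rewrite mulnDl !mulrnDr;  zmod.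
- move=> f g h f0 g0 h0; rewrite /tame resM // pvalM // qD mulrnDl.
  by rewrite mulnDr !mulrnDr; zmod.
- move=> f f0; rewrite /tame resN // pvalN // (fopprE (res f)) qD mulrnDl q_N1_sqr.
  by zmod.
move=> f g f0 g0 fg0 Pfg.
apply: (@res_steinberg B (fun f g => tame f g - tame f (f + g)
  - tame (f + g) g + tame (f + g) (f + g))) => //; rewrite /tame.
- move=> Pf Pg Ph; rewrite !(pval_ndvd _ Pf) !(pval_ndvd _ Pg) !(pval_ndvd _ Ph).
  by rewrite !mulr0n; zmod.
- move=> Pf Pg ->; rewrite !(pval_ndvd _ Pf) !(pval_ndvd _ Pg) (fopprE (res f)) qD.
  rewrite (q_N1_sqr (pval P_irr (f + g))) ?muln0 ?mul0n ?mulr0n ?mulrnDl.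
  have E := congr1 (fun x => x *+ pval P_irr (f + g)) q_N1.
  by move: E; rewrite mulrnDl mul0rn => E; apply: (zmod_lin E); zmod.
- move=> Pf Ph ->; rewrite !(pval_ndvd _ Pf) !(pval_ndvd _ Ph).
  by rewrite ?muln0 ?mul0n ?mulr0n; zmod.
- move=> Pg Ph ->; rewrite !(pval_ndvd _ Pg) !(pval_ndvd _ Ph).
  by rewrite ?muln0 ?mul0n ?mulr0n; zmod.
Qed.

Lemma tame_ndvd f g : ~~ (P %| f) -> ~~ (P %| g) -> tame f g = 0.
Proof.
by move=> Pf Pg; rewrite /tame !(pval_ndvd _ Pf) !(pval_ndvd _ Pg) !mulr0n; zmod.
Qed.

Lemma tame_self g : ~~ (P %| g) -> tame P g = - q (res g).
Proof.
move=> Pg; rewrite /tame (pval_ndvd _ Pg) muln0 !mulr0n /pval val_cofactor_self.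
by rewrite mulr1n; zmod.
Qed.

End Tame.

Section Specialization.
Context (p : nat) (B : zmodType) (s : Funits L -> Funits L -> B).
Hypothesis sP : steinberg_symbol s.
Hypothesis B_torsion : forall x : B, x *+ p = 0.

(** The specialization map for the uniformizer [P]: it sends $\{P^i u, P^j v\}$ to $\{\bar u, \bar
    v\}$. *)
Definition specialize f g : B := s (res f) (res g).

Lemma specialize_poly_symbol : poly_symbol p specialize.
Proof.
apply: (poly_symbol_local P_irr.1) => //.
- by move=> f g h f0 g0 h0; rewrite /specialize resM // (st_Dl sP).
- by move=> f g h f0 g0 h0; rewrite /specialize resM // (st_Dr sP).
- by move=> f f0; rewrite /specialize resN // (st_foppr sP).
move=> f g f0 g0 fg0 Pfg.
apply: (@res_steinberg B (fun f g => specialize f g - specialize f (f + g)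
  - specialize (f + g) g + specialize (f + g) (f + g))) => //; rewrite /specialize.
- move=> Pf Pg Ph; apply: (st_add sP); rewrite !res_ndvd //.
  by rewrite rmorphD.
- move=> Pf Pg ->; rewrite (st_foppr sP) (fopprE (res f)) (st_Dr sP).
  rewrite (st_diag sP (res (f + g))) (st_anti sP (res f) (res (f + g))).
  have E : s (res (f + g)) (foppr 0) + s (res (f + g)) (foppr 0) = 0.
    by rewrite -(st_Dr sP) foppr0D0 (st_0r sP).
  by zmod.
- by move=> Pf Ph ->; zmod.
- by move=> Pg Ph ->; zmod.
Qed.

End Specialization.
End Local.

(** * The filtration by degree *)

Lemma residue_field (F : fieldType) (P : {poly F}) : irreducible_poly P ->
  exists (L : fieldType) (ev : {rmorphism {poly F} -> L}),
    (forall f, (ev f == 0) = (P %| f)) /\ (forall y, exists f, ev f = y).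
Proof.
move=> P_irr; have [L _ [z Pz Lz]] := irredp_FAdjoin P_irr.
pose ev : {rmorphism {poly F} -> L} := horner_alg z.
have evE f : ev f = (map_poly (in_alg L) f).[z] by [].
have evP : ev P = 0 by rewrite evE; exact/eqP.
exists L, ev; split=> [f|y].
  apply/eqP/idP => [ev0|/dvdpP[g ->]]; last by rewrite rmorphM evP mulr0.
  (* If [P] did not divide [f], a Bezout combination of the two would be a nonzero constant,
     although [ev] kills both. *)
  apply/negPn/negP => Pf; have /Bezout_coprimepP[[a b]] : coprimep P f.
    have := dvdp_gcdl P f => /(irredp_XsubCP P_irr)[eq1|eqP].
      by rewrite coprimep_def (eqp_size eq1) size_poly1.
    by case/negP: Pf; rewrite -(eqp_dvdl _ eqP) dvdp_gcdr.
  move=> /eqp_size; rewrite size_poly1 => /eqP/size_poly1P[c c0 /(congr1 ev)].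
  rewrite /= rmorphD !rmorphM evP ev0 !mulr0 addr0 => /esym.
  rewrite evE map_polyC hornerC /= => /eqP.
  by rewrite scaler_eq0 oner_eq0 orbF (negPf c0).
have : y \in <<1; z>>%VS by rewrite Lz memvf.
by case/Fadjoin_polyP => q /polyOver1P[f ->] ->; exists f.
Qed.

(** The tame symbol with values in $L^*/p$, where [L] is the residue field at [P]. The last clause
    is the converse of the third: this symbol detects $p$-th powers modulo [P]. *)
Lemma tame_symbol_exists (F : fieldType) (p : nat) (P : {poly F}) :
  p != 0%N -> irreducible_poly P ->
  exists (B : zmodType) (s : {poly F} -> {poly F} -> B),
    [/\ poly_symbol p s,
        forall f g, ~~ (P %| f) -> ~~ (P %| g) -> s f g = 0,
        forall g h, ~~ (P %| g) -> P %| g - h ^+ p -> s P g = 0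
      & forall g, ~~ (P %| g) -> s P g = 0 -> exists h, P %| g - h ^+ p].
Proof.
move=> p0 P_irr; have [L [ev [ev_ker ev_surj]]] := residue_field P_irr.
pose q : {additive Funits L -> Quotient.quot (@multiples (Funits L) p)} :=
  (\pi_(Quotient.quot (@multiples (Funits L) p)))%qT.
have q_torsion (x : Quotient.quot (@multiples (Funits L) p)) : x *+ p = 0.
  rewrite -[x]reprK -raddfMn /=; apply: quot_pi_eq0; apply/multiplesP.
  by exists (repr x).
have q_eq0 g : ~~ (P %| g) -> q (res P_irr ev g) = 0 <-> exists h, P %| g - h ^+ p.
  move=> Pg; rewrite /q; split.
    move/quot_pi_eq0P/multiplesP => [y yE]; have [h hE] := ev_surj (val y).
    exists h; rewrite -ev_ker rmorphB rmorphXn hE /= subr_eq0 -Funits_valMn -yE.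
    by rewrite (res_ndvd _ ev_ker).
  move=> [h]; rewrite -ev_ker rmorphB subr_eq0 => /eqP gE.
  have evh0 : ev h != 0.
    apply: contraNneq Pg => h0; rewrite -ev_ker gE rmorphXn /= h0.
    by rewrite expr0n (negPf p0).
  apply/quot_pi_eq0P/multiplesP; exists (Sub (ev h) evh0).
  by apply: val_inj; rewrite Funits_valMn (res_ndvd _ ev_ker) // gE rmorphXn.
exists _, (tame P_irr ev q); split.
- exact: tame_poly_symbol.
- exact: tame_ndvd.
- by move=> g h Pg gh; rewrite tame_self // (q_eq0 _ Pg).2 ?oppr0 //; exists h.
- move=> g Pg; rewrite tame_self // => /eqP; rewrite oppr_eq0 => /eqP.
  by move/(q_eq0 _ Pg).
Qed.

Section Filtration.
Context (F : fieldType) (p : nat) (p_gt0 : (0 < p)%N).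
Local Notation pairs := (seq ({poly F} * {poly F})).
Implicit Types (f g h P Q : {poly F}) (l : pairs) (n : nat).

Definition psum (B : zmodType) (s : {poly F} -> {poly F} -> B) l : B :=
  \sum_(x <- l) s x.1 x.2.

(* Equality of the images of two formal sums in [K_2(F(X)) / p]. *)
Definition pequiv l1 l2 := forall (B : zmodType) (s : {poly F} -> {poly F} -> B),
  poly_symbol p s -> psum s l1 = psum s l2.

Lemma psum_nil (B : zmodType) (s : {poly F} -> {poly F} -> B) : psum s [::] = 0.
Proof. exact: big_nil. Qed.

Lemma psum_cons (B : zmodType) (s : {poly F} -> {poly F} -> B) x l :
  psum s (x :: l) = s x.1 x.2 + psum s l.
Proof. exact: big_cons. Qed.

Lemma psum_cat (B : zmodType) (s : {poly F} -> {poly F} -> B) l1 l2 :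
  psum s (l1 ++ l2) = psum s l1 + psum s l2.
Proof. exact: big_cat. Qed.

Lemma pequiv_trans l1 l2 l3 : pequiv l1 l2 -> pequiv l2 l3 -> pequiv l1 l3.
Proof. by move=> l12 l23 B s sP; rewrite l12 ?l23. Qed.

Lemma pequiv_cat l1 l2 l1' l2' :
  pequiv l1 l1' -> pequiv l2 l2' -> pequiv (l1 ++ l2) (l1' ++ l2').
Proof. by move=> e1 e2 B s sP; rewrite !psum_cat e1 ?e2. Qed.

Definition nzpair (x : {poly F} * {poly F}) := (x.1 != 0) && (x.2 != 0).

Definition swap (x : {poly F} * {poly F}) := (x.2, x.1).

Lemma psum_swap (B : zmodType) (s : {poly F} -> {poly F} -> B) l : poly_symbol p s ->
  all nzpair l -> psum s (map swap l) = - psum s l.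
Proof.
move=> sP; elim: l => [|x l IH] /=; first by rewrite psum_nil oppr0.
case/andP=> /andP[x1 x2] /IH E; rewrite !psum_cons E opprD /=.
by rewrite (ps_anti sP x2 x1).
Qed.

(** Lists have no negatives; modulo $p$, taking $p - 1$ copies replaces the change of sign. *)
Lemma psum_torsion (B : zmodType) (s : {poly F} -> {poly F} -> B) l : poly_symbol p s ->
  psum s (flatten (nseq p.-1 l)) = - psum s l.
Proof.
move=> sP; have -> : psum s (flatten (nseq p.-1 l)) = psum s l *+ p.-1.
  by elim: p.-1 => [|n IH] /=; rewrite ?psum_nil // psum_cat IH mulrS.
by apply/eqP; rewrite -addr_eq0 -mulrSr prednK // (ps_torsion sP).
Qed.

(* Symbols with entries of degree less than [n], and those whose class modulo the
   former is determined by the residue of [x.2] at the prime [x.1] of degree [n]. *)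
Definition low n : pred ({poly F} * {poly F}) :=
  fun x => [&& nzpair x, (size x.1 <= n)%N & (size x.2 <= n)%N].

Definition top n (x : {poly F} * {poly F}) : Prop :=
  [/\ irreducible_poly x.1, x.1 \is monic, size x.1 = n.+1, x.2 != 0
    & (size x.2 <= n)%N].

Definition top_seq n l := forall x, x \in l -> top n x.

Definition generated n l :=
  exists l1 l2, [/\ all (low n) l1, top_seq n l2 & pequiv l (l1 ++ l2)].

Lemma generated_nil n : generated n [::].
Proof. by exists [::], [::]. Qed.

Lemma generated_pequiv n l l' : pequiv l l' -> generated n l' -> generated n l.
Proof.
move=> ll' [l1 [l2 [low1 top2 e]]]; exists l1, l2; split=> //.
exact: (pequiv_trans ll' e).
Qed.

Lemma generated_cat n l l' :
  generated n l -> generated n l' -> generated n (l ++ l').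
Proof.
move=> [l1 [l2 [low1 top2 e]]] [l1' [l2' [low1' top2' e']]].
exists (l1 ++ l1'), (l2 ++ l2'); split.
- by rewrite all_cat low1.
- by move=> x; rewrite mem_cat => /orP[/top2|/top2'].
- move=> B s sP; rewrite !psum_cat e // e' // !psum_cat; zmod.
Qed.

Lemma generated_low n f g : low n (f, g) -> generated n [:: (f, g)].
Proof. by move=> lowfg; exists [:: (f, g)], [::]; rewrite /= lowfg. Qed.

Lemma generated_top n P g : top n (P, g) -> generated n [:: (P, g)].
Proof.
move=> topPg; exists [::], [:: (P, g)]; split=> //.
by move=> x; rewrite inE => /eqP->.
Qed.

Lemma generated_swap n f g : f != 0 -> g != 0 ->
  generated n [:: (g, f)] -> generated n [:: (f, g)].
Proof.
move=> f0 g0 genl; apply: (@generated_pequiv n _ (flatten (nseq p.-1 [:: (g, f)]))).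
  move=> B s sP; rewrite psum_torsion // !psum_cons !psum_nil !addr0 /=.
  exact: (ps_anti sP f0 g0).
by elim: p.-1 => [|k IH] /=; [exact: generated_nil | exact: (generated_cat genl IH)].
Qed.

Lemma reducible_factor f : (1 < size f)%N -> ~ irreducible_poly f ->
  exists f1 f2, [/\ f = f1 * f2, (size f1 < size f)%N & (size f2 < size f)%N].
Proof.
move=> f1 f_red; apply: contrapT => no_fact; apply: f_red; split=> // q q1 qf.
have f0 : f != 0 by rewrite -size_poly_gt0 ltnW.
have q0 : q != 0 by apply: contraTneq qf => ->; rewrite dvd0p.
rewrite -dvdp_size_eqp // eqn_leq dvdp_leq //= leqNgt; apply/negP => lt_qf.
apply: no_fact; exists (f %/ q), q; split; rewrite ?divpK //.
rewrite size_divp // ltn_subrL (ltnW f1) andbT.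
by move: q1 q0; rewrite -size_poly_gt0; case: (size q) => [|[]].
Qed.

(** If [f] has degree $n$, it either splits into factors of smaller degree or is a constant times a
    monic prime; the latter contributes a [top] symbol. *)
Lemma generated_top_low n f h : (0 < n)%N -> f != 0 -> h != 0 ->
  (size f <= n.+1)%N -> (size h <= n)%N -> generated n [:: (f, h)].
Proof.
move=> n_gt0 f0 h0 le_f le_h.
have [lt_f|ge_f] := leqP (size f) n.
  by apply: generated_low; rewrite /low /nzpair /= f0 h0 lt_f.
have sz_f : size f = n.+1 by apply/eqP; rewrite eqn_leq le_f.
have [f_irr|f_red] := pselect (irreducible_poly f); last first.
  have [|f1 [f2 [fE]]] := reducible_factor _ f_red; first by rewrite sz_f.
  rewrite sz_f !ltnS => le_f1 le_f2.
  move: (f0); rewrite fE mulf_eq0 negb_or => /andP[f10 f20].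
  apply: (@generated_pequiv n _ [:: (f1, h); (f2, h)]).
    by move=> B s sP; rewrite !psum_cons psum_nil /= (ps_Ml sP) // !addr0.
  apply: (generated_cat (l := [:: _]) (l' := [:: _]));
  by apply: generated_low; rewrite /low /nzpair /= ?f10 ?f20 h0 ?le_f1 ?le_f2.
have lc0 : (lead_coef f)%:P != 0 :> {poly F} by rewrite polyC_eq0 lead_coef_eq0.
have lcV0 : (lead_coef f)^-1 != 0 by rewrite invr_eq0 lead_coef_eq0.
pose P := (lead_coef f)^-1 *: f.
have P0 : P != 0 by rewrite scaler_eq0 negb_or lcV0.
have fE : f = (lead_coef f)%:P * P.
  by rewrite mul_polyC scalerA divff ?lead_coef_eq0 // scale1r.
apply: (@generated_pequiv n _ [:: ((lead_coef f)%:P, h); (P, h)]).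
  move=> B s sP; rewrite !psum_cons psum_nil /= {1}fE (ps_Ml sP) // !addr0 //.
apply: (generated_cat (l := [:: _]) (l' := [:: _])).
  have le_lc : (size (lead_coef f)%:P <= n)%N by rewrite size_polyC lead_coef_eq0 f0.
  by apply: generated_low; rewrite /low /nzpair /= lc0 h0 le_h le_lc.
apply: generated_top; split=> //=.
- split; first by rewrite size_scale // f_irr.1.
  move=> q q1; rewrite dvdpZr // => qf.
  by apply: (eqp_trans (f_irr.2 _ q1 qf)); rewrite eqp_sym eqp_scale.
- by rewrite monicE lead_coefZ mulVf ?lead_coef_eq0.
- by rewrite size_scale.
Qed.

(** A reducible entry is split by bilinearity. For two primes of degree $n$, a Steinberg relation
    trades the symbol for ones with an entry of smaller degree. *)
Lemma generated_pair n f h : (0 < n)%N -> f != 0 -> h != 0 ->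
  (size f <= n.+1)%N -> (size h <= n.+1)%N -> generated n [:: (f, h)].
Proof.
move=> n_gt0.
have red f' h' : f' != 0 -> h' != 0 -> (size f' <= n.+1)%N ->
    (size h' <= n.+1)%N -> ~ irreducible_poly f' -> generated n [:: (f', h')].
  move=> f0 h0 le_f le_h f_red.
  have [le1_f|gt1_f] := leqP (size f') 1.
    apply: generated_swap => //; apply: generated_top_low => //.
    exact: leq_trans le1_f n_gt0.
  have [|f1 [f2 [fE]]] := reducible_factor _ f_red => //.
  move=> /leq_trans/(_ le_f); rewrite ltnS => le_f1.
  move=> /leq_trans/(_ le_f); rewrite ltnS => le_f2.
  move: (f0); rewrite fE mulf_eq0 negb_or => /andP[f10 f20].
  apply: (@generated_pequiv n _ [:: (f1, h'); (f2, h')]).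
    by move=> B s sP; rewrite !psum_cons psum_nil /= (ps_Ml sP) // !addr0.
  by apply: (generated_cat (l := [:: _]) (l' := [:: _]));
    apply: generated_swap => //; apply: generated_top_low.
move=> f0 h0 le_f le_h.
have [f_irr|] := pselect (irreducible_poly f); last exact: red.
have [h_irr|h_red] := pselect (irreducible_poly h); last first.
  by apply: generated_swap => //; exact: red.
have [lt_h|ge_h] := leqP (size h) n; first exact: generated_top_low.
have [lt_f|ge_f] := leqP (size f) n.
  by apply: generated_swap => //; exact: generated_top_low.
(* Subtracting a multiple, [h = c f + r] with [size r <= n]. *)
pose c := lead_coef h / lead_coef f; pose r := h - c *: f.
have c0 : c != 0 by rewrite mulf_neq0 ?invr_eq0 ?lead_coef_eq0.
have cP0 : c%:P != 0 :> {poly F} by rewrite polyC_eq0.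
have sz_c : (size (c%:P : {poly F}) <= n)%N by rewrite size_polyC c0.
have sz_f : size f = n.+1 by apply/eqP; rewrite eqn_leq le_f.
have sz_h : size h = n.+1 by apply/eqP; rewrite eqn_leq le_h.
have hE : h = c%:P * f + r by rewrite mul_polyC addrC subrK.
have le_r : (size r <= n)%N.
  rewrite -ltnS; have : r`_n = 0.
    rewrite coefB coefZ; have -> : n = (size f).-1 by rewrite sz_f.
    rewrite -/(lead_coef f) divfK ?lead_coef_eq0 // lead_coefE sz_f -sz_h.
    by rewrite -lead_coefE subrr.
  move=> rn0; rewrite ltnS; apply/leq_sizeP => j.
  rewrite leq_eqVlt => /orP[/eqP<- //|lt_nj].
  apply: (leq_sizeP _ _ _ _ lt_nj).
  rewrite (leq_trans (size_polyD _ _)) // size_polyN geq_max le_h.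
  by rewrite (leq_trans (size_scale_leq _ _)).
have le1 : (size (- 1%R : {poly F})%R <= n)%N by rewrite size_polyN size_poly1.
have N10 : -1 != 0 :> {poly F} by rewrite oppr_eq0 oner_neq0.
(* If $h = c f$, then $\{f, h\} = \{f, c\} + \{f, f\}$ and $\{f, f\} = \{f, -1\}$. *)
have [r0|r_neq0] := eqVneq r 0.
  apply: (@generated_pequiv n _ [:: (f, c%:P); (f, -1)]).
    move=> B s sP; rewrite !psum_cons psum_nil /= !addr0 hE r0 addr0.
    by rewrite (ps_Mr sP) // (ps_diag sP).
  by apply: (generated_cat (l := [:: _]) (l' := [:: _])); exact: generated_top_low.
(* The Steinberg relation for $c f + r = h$, solved for $\{f, h\}$. *)
apply: (@generated_pequiv n _ [:: (f, r); (r, h); (h, -1); (h, c%:P); (c%:P, r)]).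
  move=> B s sP; rewrite !psum_cons psum_nil /= !addr0.
  have cf0 : c%:P * f != 0 by rewrite mulf_neq0.
  have hE' : c%:P * f + r != 0 by rewrite -hE.
  have := ps_steinberg sP cf0 r_neq0 hE'; rewrite -hE.
  rewrite !(ps_Ml sP) // (ps_diag sP h0) (ps_anti sP cP0 h0).
  rewrite (ps_anti sP h0 r_neq0) => E; apply: (zmod_lin (esym E)); zmod.
apply: (generated_cat (l := [:: _])); first exact: generated_top_low.
apply: (generated_cat (l := [:: _])).
  by apply: generated_swap => //; exact: generated_top_low.
apply: (generated_cat (l := [:: _])); first exact: generated_top_low.
apply: (generated_cat (l := [:: _])); first exact: generated_top_low.
by apply: generated_low; rewrite /low /nzpair /= r_neq0 cP0 le_r sz_c.
Qed.

Lemma generated_all n l : (0 < n)%N -> all (low n.+1) l -> generated n l.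
Proof.
move=> n_gt0; elim: l => [|[f g] l IH] /=; first by move=> _; exact: generated_nil.
case/andP=> /and3P[/andP[f0 g0] le_f le_g] /IH.
by apply: (generated_cat (l := [:: _])); exact: generated_pair.
Qed.

Lemma small_ndvdp n P g : size P = n.+1 -> g != 0 -> (size g <= n)%N -> ~~ (P %| g).
Proof.
move=> sz_P g0 le_g; apply/negP => /(dvdp_leq g0); rewrite sz_P.
by move/leq_trans => /(_ _ le_g); rewrite ltnn.
Qed.

Lemma low_ndvdp n P x : size P = n.+1 -> low n x ->
  ~~ (P %| x.1) && ~~ (P %| x.2).
Proof.
by move=> sz_P /and3P[/andP[x1 x2] le1 le2]; rewrite !(small_ndvdp sz_P).
Qed.

Lemma low_neq0 n l : all (low n) l -> all nzpair l.
Proof. by apply: sub_all => x /and3P[]. Qed.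

Lemma low_swap n l : all (low n) l -> all (low n) (map swap l).
Proof.
rewrite all_map; apply: sub_all => x /and3P[/andP[x1 x2] le1 le2].
by rewrite /= /low /nzpair /= x1 x2 le1 le2.
Qed.

(** With $g g' = q P + r$ the division by $P$, the Steinberg relation for this sum turns $\{P, g
    g'\}$ into $\{P, r\}$ plus symbols in $g$, $g'$, $q$, $r$ and $-1$, all of degree less than
    $n$. *)
Lemma top_mul n P g g' : (0 < n)%N -> top n (P, g) -> top n (P, g') ->
  exists r l, [/\ top n (P, r), all (low n) l, P %| r - g * g' &
    pequiv [:: (P, g); (P, g')] ((P, r) :: l)].
Proof.
move=> n_gt0 [/= P_irr P_mon sz_P g0 le_g] [/= _ _ _ g'0 le_g'].
have P0 : P != 0 by rewrite monic_neq0.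
pose r := (g * g') %% P; pose q := (g * g') %/ P.
have Pg : ~~ (P %| g * g').
  by rewrite (irreducible_dvdpM P_irr) negb_or !(small_ndvdp sz_P).
have r0 : r != 0 by [].
have gg'E : g * g' = q * P + r by exact: divp_eq.
have le_r : (size r <= n)%N by rewrite -ltnS -sz_P ltn_modp.
have top_r : top n (P, r) by split.
have dv_r : P %| r - g * g' by rewrite gg'E opprD addrCA subrr addr0 dvdpNr dvdp_mull.
have [q0|q0] := eqVneq q 0.
  exists r, [::]; split=> // B s sP; rewrite !psum_cons !psum_nil /= addrA.
  by rewrite -(ps_Mr sP) // gg'E q0 mul0r add0r.
have le_q : (size q <= n)%N.
  rewrite size_divp // sz_P /= size_mul //.
  move: le_g le_g'; rewrite -size_poly_gt0 in g0.
  case: (size g) g0 => // a _ le_a le_b; rewrite addSn /=.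
  by rewrite leq_subLR; apply: leq_add => //; exact: ltnW.
have N10 : -1 != 0 :> {poly F} by rewrite oppr_eq0 oner_neq0.
have le1 : (size (- 1%R : {poly F})%R <= n)%N by rewrite size_polyN size_poly1.
exists r, [:: (q, r); (g, q); (g', q); (r, g); (r, g'); (g, -1); (g', -1)].
split=> //.
  by rewrite /= /low /nzpair /= q0 r0 g0 g'0 le_q le_r le_g le_g' N10 le1.
move=> B s sP; rewrite !psum_cons !psum_nil /= !addr0.
have qP0 : q * P != 0 by rewrite mulf_neq0.
have gg'0 : g * g' != 0 by rewrite mulf_neq0.
have := ps_steinberg sP qP0 r0; rewrite -gg'E => /(_ gg'0).
rewrite (ps_diag sP gg'0) !(ps_Ml sP) // !(ps_Mr sP) //.
rewrite (ps_anti sP q0 g0) (ps_anti sP q0 g'0) (ps_anti sP g0 r0) (ps_anti sP g'0 r0).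
by move=> E; apply: (zmod_lin (esym E)); zmod.
Qed.

Lemma top_prod n P (gs : seq {poly F}) : (0 < n)%N ->
  irreducible_poly P -> P \is monic -> size P = n.+1 ->
  (forall g, g \in gs -> top n (P, g)) ->
  exists r l, [/\ top n (P, r), all (low n) l, P %| r - \prod_(g <- gs) g &
    pequiv [seq (P, g) | g <- gs] ((P, r) :: l)].
Proof.
move=> n_gt0 P_irr P_mon sz_P; have P0 := monic_neq0 P_mon.
elim: gs => [_|g gs IH top_gs].
  exists 1, [::]; rewrite big_nil subrr dvdp0; split=> //.
    by split; rewrite //= ?oner_neq0 ?size_poly1.
  by move=> B s sP; rewrite psum_cons !psum_nil /= (ps_1r sP) // addr0.
have [|r [l [top_r low_l Pr e]]] := IH.
  by move=> h hs; apply: top_gs; rewrite inE hs orbT.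
have top_g : top n (P, g) by apply: top_gs; rewrite inE eqxx.
have [r' [l' [top_r' low_l' Pr' e']]] := top_mul n_gt0 top_g top_r.
exists r', (l' ++ l); split=> //.
- by rewrite all_cat low_l'.
- rewrite big_cons -[r'](subrK (g * r)) -addrA -mulrBr.
  by rewrite dvdp_add // dvdp_mull.
- move=> B s sP; rewrite /= psum_cons e // psum_cons addrA psum_cons psum_cat addrA.
  by rewrite -psum_cons -(e' _ _ sP) !psum_cons psum_nil addr0.
Qed.

(** * Lowering the degree of unramified sums *)

Definition lowrep n l := exists2 l', all (low n) l' & pequiv l l'.

Lemma lowrep_pequiv n l l' : pequiv l l' -> lowrep n l' -> lowrep n l.
Proof. by move=> e [l1 low1 e1]; exists l1 => //; exact: (pequiv_trans e e1). Qed.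

Lemma lowrep_cat n l l' : lowrep n l -> lowrep n l' -> lowrep n (l ++ l').
Proof.
move=> [l1 low1 e1] [l2 low2 e2]; exists (l1 ++ l2); first by rewrite all_cat low1.
exact: pequiv_cat.
Qed.

Lemma lowrep_low n l : all (low n) l -> lowrep n l.
Proof. by exists l. Qed.

(* [l] has trivial residue at [P] modulo [p]-th powers. *)
Definition unramified P l :=
  forall (B : zmodType) (s : {poly F} -> {poly F} -> B), poly_symbol p s ->
    (forall f g, ~~ (P %| f) -> ~~ (P %| g) -> s f g = 0) ->
    (forall g h, ~~ (P %| g) -> P %| g - h ^+ p -> s P g = 0) ->
  psum s l = 0.

Lemma unramified_low n P l : size P = n.+1 -> all (low n) l -> unramified P l.
Proof.
move=> sz_P low_l B s sP s0 _; rewrite /psum big_seq big1 // => x xl.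
by have /andP[] := low_ndvdp sz_P (allP low_l x xl); exact: s0.
Qed.

(** Apply [top_prod] to $p$ copies of $\{P, h\}$, whose sum vanishes. The reduced product agrees
    with [r] modulo [P] and both have degree less than $n$, so they are equal and $\{P, r\}$ is
    minus a low sum. *)
Lemma lowrep_top n P r : (0 < n)%N -> top n (P, r) ->
  (exists h, P %| r - h ^+ p) -> lowrep n [:: (P, r)].
Proof.
move=> n_gt0 [/= P_irr P_mon sz_P r0 le_r] [h Ph].
have P0 := monic_neq0 P_mon.
pose h' := h %% P.
have Ph' : P %| r - h' ^+ p.
  have Phh' : P %| h - h' by rewrite /h' {1}(divp_eq h P) addrK dvdp_mull.
  rewrite -[r](subrK (h ^+ p)) -addrA dvdp_add // subrXX dvdp_mulr //.
have h'0 : h' != 0.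
  apply: contraNneq (small_ndvdp sz_P r0 le_r) => h0.
  by move: Ph'; rewrite h0 expr0n eqn0Ngt p_gt0 subr0.
have top_h' : top n (P, h').
  by split=> //=; rewrite -ltnS -sz_P ltn_modp.
have [|r' [l [[/= _ _ _ r'0 le_r'] low_l Pr' e]]] :=
  @top_prod n P (nseq p h') n_gt0 P_irr P_mon sz_P.
  by move=> g; rewrite mem_nseq => /andP[_ /eqP->].
have rr' : r' = r.
  apply/eqP; rewrite -subr_eq0; apply: contraTT Pr' => rr'.
  rewrite big_nseq iter_mulr_1.
  rewrite -[r'](subrK r) -addrA dvdp_addl //; apply: (small_ndvdp sz_P rr').
  by rewrite (leq_trans (size_polyD _ _)) // size_polyN geq_max le_r'.
(* By anticommutativity, swapping the entries negates the sum. *)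
exists (map swap l); first exact: low_swap.
move=> B s sP; rewrite (psum_swap sP) ?(low_neq0 low_l) //.
have := e _ s sP; rewrite !psum_cons psum_nil rr' => E.
have E0 : psum s [seq (P, g) | g <- nseq p h'] = 0.
  by rewrite /psum big_map big_nseq -[RHS](ps_torsion sP (s P h')) iter_addr_0.
rewrite E0 in E; apply: (zmod_lin (esym E)); zmod.
Qed.

(** Treat one prime [P] at a time: its symbols merge into a single $\{P, r\}$. No other term has a
    residue at [P], so [r] is a $p$-th power modulo [P] and $\{P, r\}$ is low. *)
Lemma lowrep_unramified n l : (0 < n)%N -> top_seq n l ->
  (forall P, irreducible_poly P -> P \is monic -> size P = n.+1 -> unramified P l) ->
  lowrep n l.
Proof.
move=> n_gt0; have [m le_lm] := ubnP (size l); elim: m => // m IH in l le_lm *.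
case: l le_lm => [|x l] le_lm top_l unr_l; first exact: lowrep_low.
pose P := x.1; pose l1 := [seq y <- x :: l | y.1 == P].
pose l2 := [seq y <- x :: l | y.1 != P].
have [P_irr P_mon sz_P _ _] : top n x by apply: top_l; rewrite inE eqxx.
have l12 : pequiv (x :: l) (l1 ++ l2).
  move=> B s sP; rewrite psum_cat /psum !big_filter.
  by rewrite (bigID (fun y => y.1 == P)).
have l1E : l1 = [seq (P, g) | g <- map snd l1].
  rewrite -map_comp -[LHS]map_id; apply/eq_in_map => -[Q g].
  by rewrite mem_filter => /andP[/eqP/= -> _].
have [|r [l0 [top_r low_l0 _ e1]]] := @top_prod n P (map snd l1) n_gt0 P_irr P_mon sz_P.
  move=> g /mapP[[Q g']]; rewrite mem_filter /= => /andP[/eqP -> yl] ->.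
  exact: top_l.
rewrite -l1E in e1.
have lE : pequiv (x :: l) ((P, r) :: l0 ++ l2).
  by apply: (pequiv_trans l12); rewrite -cat_cons; exact: pequiv_cat.
have top_l2 : top_seq n l2.
  by move=> y; rewrite mem_filter => /andP[_]; exact: top_l.
have lowrep_r : lowrep n [:: (P, r)].
  apply: lowrep_top => //.
  have p0 : p != 0%N by rewrite -lt0n.
  have [B [s [sP s_ndvd s_pow s_pow']]] := tame_symbol_exists p0 P_irr.
  have [/= _ _ _ r0 le_r] := top_r.
  apply: (s_pow' r); first exact: (small_ndvdp sz_P).
  have := unr_l P P_irr P_mon sz_P B s sP s_ndvd s_pow.
  rewrite lE // psum_cons psum_cat (unramified_low sz_P low_l0 sP) // add0r /=.
  suff -> : psum s l2 = 0 by rewrite addr0.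
  rewrite /psum big_seq big1 // => y yl2.
  have [Q_irr Q_mon sz_Q g0 le_g] := top_l2 y yl2.
  apply: s_ndvd; last exact: (small_ndvdp sz_P).
  apply/negP => /(Q_irr.2 _ _) eqPQ.
  move: yl2; rewrite mem_filter => /andP[/negP[]]; rewrite eq_sym -eqp_monic // eqPQ //.
  by rewrite sz_P; case: (n) n_gt0.
apply: (lowrep_pequiv lE); rewrite -cat1s; apply: lowrep_cat => //.
apply: lowrep_cat; first exact: lowrep_low.
have [l' low_l' e'] := lowrep_r.
apply: IH => //.
  apply: leq_trans (_ : size l2 < size (x :: l))%N _; last by rewrite -ltnS.
  by rewrite /l2 /= eqxx /= ltnS size_filter count_size.
(* The part removed from the list is equivalent to a low sum, hence unramified at every prime of
   degree $n$. *)
move=> Q Q_irr Q_mon sz_Q B s sP s0 s1.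
have := unr_l Q Q_irr Q_mon sz_Q B s sP s0 s1; rewrite lE // -cat1s !psum_cat e' //.
by rewrite (unramified_low sz_Q low_l' sP s0 s1)
  (unramified_low sz_Q low_l0 sP s0 s1) !add0r.
Qed.

Lemma lowrep_step n l : (0 < n)%N -> all (low n.+1) l ->
  (forall P, irreducible_poly P -> P \is monic -> size P = n.+1 -> unramified P l) ->
  lowrep n l.
Proof.
move=> n_gt0 /(generated_all n_gt0)[l1 [l2 [low1 top2 e]]] unr_l.
apply: (lowrep_pequiv e); apply: lowrep_cat; first exact: lowrep_low.
apply: lowrep_unramified => // P P_irr P_mon sz_P B s sP s0 s1.
have := unr_l P P_irr P_mon sz_P B s sP s0 s1.
by rewrite e // psum_cat (unramified_low sz_P low1 sP s0 s1) add0r.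
Qed.

(* The part of the Milnor-Tate exact sequence
   [K_2(F) / p -> K_2(F(X)) / p -> \bigoplus_P (F[X] / P)^* / p] that is needed. *)
Lemma unramified_constant l : all nzpair l ->
  (forall P, irreducible_poly P -> P \is monic -> unramified P l) -> lowrep 1 l.
Proof.
move=> nz_l unr_l.
have [n low_l] : exists n, all (low n.+1) l.
  elim: l nz_l {unr_l} => [|x l IH] /=; first by exists 0%N.
  case/andP=> nz_x /IH[n low_l]; exists (maxn n (maxn (size x.1) (size x.2))).
  apply/andP; split.
    rewrite /low nz_x /=; apply/andP.
    by split; apply: leqW; rewrite !leq_max leqnn ?orbT.
  apply: sub_all low_l => y /and3P[nz_y le1 le2]; rewrite /low nz_y.
  by rewrite (leq_trans le1) ?(leq_trans le2) // ltnS leq_maxl.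
(* Descend one degree at a time, down to [low 1], the pairs of nonzero constants. *)
elim: n l nz_l unr_l low_l => [|n IH] l nz_l unr_l low_l; first exact: lowrep_low.
have [//||l' low_l' e] := @lowrep_step n.+1 l _ low_l.
  by move=> P P_irr P_mon _; exact: unr_l.
apply: (lowrep_pequiv e); apply: IH (low_l'); first exact: low_neq0 low_l'.
move=> P P_irr P_mon B s sP s0 s1; rewrite -e //.
exact: (unr_l P).
Qed.

End Filtration.

(** * The norm form *)

(* Multiplication by [\sum_k x k * theta ^ k] on [R[theta] / (theta ^ p - a)]. *)
Definition normmx (R : comNzRingType) p (a : R) (x : nat -> R) : 'M[R]_p :=
  \matrix_(i, j) if (i <= j)%N then x (j - i)%N else a * x (j + p - i)%N.

Definition normf (R : comNzRingType) p (a : R) (x : nat -> R) : R :=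
  \det (normmx p a x).

Lemma normf_morph (R S : comNzRingType) (f : {rmorphism R -> S}) p a x :
  f (normf p a x) = normf p (f a) (f \o x).
Proof.
rewrite /normf -det_map_mx; congr (\det _); apply/matrixP => i j.
by rewrite !mxE; case: ifP => // _; rewrite rmorphM.
Qed.

Lemma eq_normf (R : comNzRingType) p (a : R) (x y : nat -> R) :
  (forall k, (k < p)%N -> x k = y k) -> normf p a x = normf p a y.
Proof.
move=> xy; congr (\det _); apply/matrixP => i j; rewrite !mxE.
have [le_ij|lt_ji] := leqP i j; first by rewrite xy // (leq_ltn_trans (leq_subr _ _)).
by rewrite xy // ltn_subLR ?ltn_add2r // (leq_trans (ltnW (ltn_ord i))) ?leq_addl.
Qed.

(** At [a = 0] the matrix is triangular with [x 0] along the diagonal. *)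
Lemma normf_0 (R : comNzRingType) p (x : nat -> R) : normf p 0 x = x 0%N ^+ p.
Proof.
rewrite /normf -det_tr det_trig; last first.
  by apply/is_trig_mxP => i j lt_ij; rewrite !mxE leqNgt lt_ij mul0r.
by under eq_bigr do rewrite !mxE leqnn subnn; rewrite prodr_const card_ord.
Qed.

(** Factor $\theta$ out of an element without constant term: the matrix [C] of multiplication by
    $\theta$ has determinant $(-1)^n a$, with $p = n + 1$. *)
Lemma normf_shift (R : comNzRingType) n (a : R) (x : nat -> R) :
  x 0%N = 0 -> x n.+1 = 0 ->
  normf n.+1 a x = (-1) ^+ n * a * normf n.+1 a (fun k => x k.+1).
Proof.
move=> x0 xp; pose C : 'M[R]_n.+1 := \matrix_(i, j)
  if (i < n)%N then (j == i.+1 :> nat)%:R else if j == 0 :> nat then a else 0.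
have -> : (-1) ^+ n * a = \det C.
  rewrite (expand_det_row C ord_max) (bigD1 ord0) //= big1 ?addr0; last first.
    by move=> j; rewrite -val_eqE /= !mxE /= ltnn => /negPf ->; rewrite mul0r.
  rewrite mxE /= ltnn /cofactor addn0 mulrCA; congr (_ * _).
  suff -> : row' ord_max (col' ord0 C) = 1%:M by rewrite det1 mulr1.
  apply/matrixP => i j; rewrite !mxE lift_max ltn_ord lift0 eqSS.
  by rewrite eq_sym.
rewrite /normf -det_mulmx; congr (\det _); apply/matrixP => i j; rewrite !mxE.
have [lt_in|ge_in] := ltnP i n.
  have lt_iS : (i.+1 < n.+1)%N by rewrite ltnS.
  rewrite (bigD1 (Ordinal lt_iS)) //= big1 ?addr0; last first.
    by move=> k; rewrite -val_eqE /= !mxE lt_in => /negPf ->; rewrite mul0r.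
  rewrite !mxE lt_in eqxx mul1r /=.
  case: (ltngtP i j) => [lt_ij|lt_ji|eq_ij].
  - by rewrite -subnSK.
  - by rewrite addnS subSS -subSn // (leq_trans (ltnW lt_in)) // leq_addl.
  - by rewrite eq_ij subnn x0 addnS subSS addKn xp mulr0.
rewrite (bigD1 ord0) //= big1 ?addr0; last first.
  by move=> k; rewrite -val_eqE /= !mxE ltnNge ge_in /= => /negPf ->; rewrite mul0r.
rewrite !mxE ltnNge ge_in /= subn0.
have -> : i = n :> nat by apply/eqP; rewrite eqn_leq ge_in -ltnS ltn_ord.
have [le_nj|lt_jn] := leqP n j.
  have -> : j = n :> nat by apply/eqP; rewrite eqn_leq le_nj -ltnS ltn_ord.
  by rewrite subnn x0 xp mulr0.
by rewrite addnS -addSn addnK.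
Qed.

Section NormZero.
Context (E : fieldType) (p : nat).

Lemma char_poly_exists n (g : {poly E}) : g \is monic -> size g = n.+2 ->
  exists A : 'M[E]_n.+1, char_poly A = g.
Proof.
move=> g_mon sz_g; have := companionmxK g_mon.
by move: (companionmx g); rewrite sz_g => A; exists A.
Qed.

(** Choosing $u d = v p + 1$ gives $a = (w^u / a^v)^p$. *)
Lemma prime_power_root (a w : E) d : prime p -> (0 < d < p)%N -> w ^+ p = a ^+ d ->
  exists v, a = v ^+ p.
Proof.
move=> p_pr /andP[d0 lt_dp] wa.
have [->|a0] := eqVneq a 0; first by exists 0; rewrite expr0n eqn0Ngt prime_gt0.
have co_pd : coprime d p by rewrite coprime_sym prime_coprime // gtnNdvd.
have [u v uv _] := egcdnP p d0.
exists (w ^+ u / a ^+ v); rewrite expr_div_n -!exprM mulnC exprM wa -exprM.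
by rewrite mulnC uv (eqP co_pd) exprD expr1 mulrAC divff ?mul1r // expf_neq0.
Qed.

(** A kernel vector yields $V \neq 0$ of degree less than $p$ with $X^p - a$ dividing $V f$, so $g =
    \gcd(f, X^p - a)$ has degree $d$ with $0 < d < p$. A matrix $A$ with characteristic polynomial
    $g$ satisfies $A^p = a$; determinants give $\det(A)^p = a^d$, and $d$ is prime to $p$. *)
Lemma normf_eq0 (a : E) (x : nat -> E) (i : nat) : prime p ->
  (i < p)%N -> x i != 0 -> normf p a x = 0 -> exists v, a = v ^+ p.
Proof.
move=> p_pr lt_ip xi /eqP/det0P[v v0 vM].
have p_gt0 := prime_gt0 p_pr.
pose f := \poly_(k < p) x k; pose V := rVpoly v.
have f0 : f != 0.
  apply: contraNneq xi => f0; have : f`_i = 0 by rewrite f0 coef0.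
  by rewrite coef_poly lt_ip => ->.
have V0 : V != 0 by apply: contraNneq v0 => V0; rewrite -[v]rVpolyK -/V V0 linear0.
have le_f : (size f <= p)%N by exact: size_poly.
have le_V : (size V <= p)%N by exact: size_poly.
have VfE m : (V * f)`_m = \sum_(i < p) v 0 i * (if (m < i)%N then 0 else f`_(m - i)).
  have -> : V = \sum_(i < p) v 0 i *: 'X^i.
    rewrite /V /rVpoly poly_def; apply: eq_bigr => k _.
    by rewrite valK.
  rewrite mulr_suml coef_sum; apply: eq_bigr => k _.
  by rewrite -scalerAl coefZ coefXnM.
(* The quotient of $V f$ by $X^p - a$: by [vM], the coefficient of $V f$ in degree $m < p$ is $-a$
   times the one in degree $m + p$. *)
pose W := \poly_(j < p) (V * f)`_(j + p).
have WE j : W`_j = (V * f)`_(j + p).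
  rewrite coef_poly; case: ltnP => // le_pj; rewrite VfE big1 // => k _.
  rewrite ltnNge (leq_trans (ltnW (ltn_ord k))) ?leq_addl //=.
  rewrite coef_poly ltnNge leq_subRL ?(leq_trans (ltnW (ltn_ord k))) ?leq_addl //.
  by rewrite leq_add2r (leq_trans (ltnW (ltn_ord k))) ?mulr0.
have dv : 'X^p - a%:P %| V * f.
  suff -> : V * f = W * ('X^p - a%:P) by exact: dvdp_mull.
  apply/polyP => m; rewrite [W * _]mulrC mulrBl coefB coefXnM coefCM !WE.
  have [lt_mp|le_pm] := ltnP m p.
    have := congr1 (fun u : 'rV_p => u 0 (Ordinal lt_mp)) vM.
    rewrite !mxE => vM0; apply/eqP; rewrite sub0r -addr_eq0 -[X in _ == X]vM0.
    rewrite !VfE mulr_sumr -big_split; apply/eqP/eq_bigr => k _ /=.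
    rewrite !mxE /= !coef_poly ltnNge; have [le_km|lt_mk] := leqP k m => /=.
      rewrite (leq_ltn_trans (leq_subr _ _) lt_mp) ltnNge.
      rewrite (leq_trans (ltnW (ltn_ord k))) ?leq_addl //= ltnNge leq_subRL.
        by rewrite leq_add2r le_km !mulr0 addr0.
      by rewrite (leq_trans (ltnW (ltn_ord k))) ?leq_addl.
    rewrite mulr0 add0r ltnNge (leq_trans (ltnW (ltn_ord k))) ?leq_addl //=.
    by rewrite ltn_subLR ?ltn_add2r ?lt_mk ?(leq_trans (ltnW (ltn_ord k))) ?leq_addl // mulrCA.
  rewrite subnK // -[LHS]subr0; congr (_ - _).
  rewrite -WE coef_poly ltnNge le_pm /=.
  by rewrite mulr0.
have sz_X : size ('X^p - a%:P : {poly E}) = p.+1 by exact: size_XnsubC.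
have X0 : 'X^p - a%:P != 0 :> {poly E} by rewrite -size_poly_gt0 sz_X.
pose g0 := gcdp f ('X^p - a%:P); pose g := (lead_coef g0)^-1 *: g0.
have g00 : g0 != 0 by rewrite gcdp_eq0 negb_and f0.
have lc0 : (lead_coef g0)^-1 != 0 by rewrite invr_eq0 lead_coef_eq0.
have g_mon : g \is monic by rewrite monicE lead_coefZ mulVf ?lead_coef_eq0.
have sz_g : size g = size g0 by rewrite size_scale.
have g_dv : g %| 'X^p - a%:P by rewrite dvdpZl // dvdp_gcdr.
have le_g : (size g <= p)%N by rewrite sz_g (leq_trans _ le_f) // dvdp_leq // dvdp_gcdl.
(* Otherwise $X^p - a$ would be prime to $f$ and divide $V$, whose degree is too small. *)
have g1 : (size g != 1)%N.
  rewrite sz_g -/(coprimep _ _) coprimep_sym; apply/negP => co.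
  have : 'X^p - a%:P %| V by rewrite -(Gauss_dvdpl _ co).
  by move/(dvdp_leq V0); rewrite sz_X => /leq_trans/(_ le_V); rewrite ltnn.
have g_nz : size g != 0%N by rewrite size_poly_eq0 monic_neq0.
have [n szg] : exists n, size g = n.+2.
  by case: (size g) g_nz g1 => [|[|n]] // _ _; exists n.
have [A Ag] := char_poly_exists g_mon szg.
have Ap : A ^+ p = a%:M.
  apply/eqP; rewrite -subr_eq0 -(horner_mx_C A) -{1}(horner_mx_X A) -rmorphXn -rmorphB /=.
  by move: g_dv => /dvdpP[h ->]; rewrite rmorphM /= -Ag Cayley_Hamilton mulr0.
apply: (@prime_power_root a (\det A) n.+1 p_pr); first by rewrite /= -szg.
rewrite -[RHS]det_scalar -Ap.
by elim: (p) => [|q IH]; rewrite ?expr0 ?det1 // !exprS det_mulmx IH.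
Qed.

End NormZero.

(** * Symbols with a norm entry *)

Section SymbolNorm.
Context (F : fieldType) (p : nat) (p_pr : prime p).
Implicit Types (x : nat -> F) (a c : Funits F).

(* The norm of [\sum_k x k * theta ^ k] when [theta ^ p] is the variable. *)
Definition norm_poly x : {poly F} := normf p 'X (fun k => (x k)%:P).

Lemma norm_poly_horner x (b : F) : (norm_poly x).[b] = normf p b x.
Proof.
rewrite -[LHS]/(horner_eval b _) normf_morph /= /horner_eval hornerX.
by apply: eq_normf => k _ /=; rewrite /horner_eval hornerC.
Qed.

Let p_gt0 : (0 < p)%N := prime_gt0 p_pr.

(** At $P = X$ the norm is $x_0^p$ modulo $X$. At a prime $P \neq X$ dividing the norm, the norm
    form over the residue field has a zero, nontrivial because $x_0 \neq 0$, so the image of $X$ is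
    a $p$-th power by [normf_eq0]. Elsewhere both entries are prime to $P$. *)
Lemma norm_poly_unramified x P : x 0%N != 0 -> norm_poly x != 0 ->
  irreducible_poly P -> P \is monic -> unramified p P [:: ('X, norm_poly x)].
Proof.
move=> x0 N0 P_irr P_mon B s sP s_ndvd s_pow.
rewrite psum_cons psum_nil addr0 /=.
have X0 : 'X != 0 :> {poly F} by rewrite polyX_eq0.
have XE : 'X = 'X - 0%:P :> {poly F} by rewrite subr0.
have [PX|PX] := boolP (P %| 'X).
  have PXE : P = 'X.
    apply/eqP; rewrite -eqp_monic ?monicX //.
    have X_irr : irreducible_poly ('X : {poly F}).
      by rewrite XE; exact: irredp_XsubC.
    by apply: X_irr.2 => //; rewrite neq_ltn P_irr.1 orbT.
  have XdvdE (f : {poly F}) : ('X %| f) = (f.[0] == 0).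
    by rewrite {1}XE dvdp_XsubCl.
  rewrite -PXE; apply: (s_pow _ (x 0%N)%:P).
    by rewrite PXE XdvdE norm_poly_horner normf_0 expf_neq0.
  by rewrite PXE XdvdE !hornerE norm_poly_horner normf_0 subrr.
have [PN|PN] := boolP (P %| norm_poly x); last exact: s_ndvd.
have [h Ph] : exists h, P %| 'X - h ^+ p.
  have [L [ev [ev_ker ev_surj]]] := residue_field P_irr.
  have /eqP evN : ev (norm_poly x) == 0 by rewrite ev_ker.
  rewrite normf_morph in evN.
  have evx0 : (ev \o (fun k => (x k)%:P)) 0%N != 0.
    rewrite /= ev_ker; apply/negP => /dvdp_leq; rewrite polyC_eq0 => /(_ x0).
    by rewrite size_polyC x0 leqNgt P_irr.1.
  have [w evX] := normf_eq0 p_pr p_gt0 evx0 evN.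
  have [h wE] := ev_surj w; exists h.
  by rewrite -ev_ker rmorphB rmorphXn wE evX subrr.
have sPX : s P 'X = 0 by exact: (s_pow _ h).
have P0 : P != 0 := monic_neq0 P_mon.
have PX' : ~~ (P %| pcof P_irr (norm_poly x)) by exact: pcof_ndvd.
(* Write the norm as $P^v u$: both $\{X, P\} = -\{P, X\}$ and $\{X, u\}$ are sent to $0$. *)
rewrite (pval_pcofE P_irr N0) (ps_Mr sP) ?expf_neq0 ?(ndvdp_neq0 PX') //.
by rewrite (ps_Xr sP) // (ps_anti sP X0 P0) sPX oppr0 mul0rn add0r s_ndvd.
Qed.

Context (B : zmodType) (s : Funits F -> Funits F -> B).
Hypothesis sP : steinberg_symbol s.
Hypothesis B_torsion : forall y : B, y *+ p = 0.

(** By [unramified_constant], $\{X, N_X\}$ is modulo $p$ a sum of symbols of constants, so its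
    specializations at $X = a$ and $X = 1$ agree. They are $\{a, c\}$ and $\{1, N_1\} = 0$, the
    latter even if $N_1$ vanishes, since [res] is always a unit. *)
Lemma symbol_norm_poly a c x : x 0%N != 0 -> val c = normf p (val a) x ->
  s a c = 0.
Proof.
move=> x0 cE.
have N0 : norm_poly x != 0.
  by apply: contraNneq (valP c) => N0; rewrite cE -norm_poly_horner N0 horner0.
have X0 : 'X != 0 :> {poly F} by rewrite polyX_eq0.
have [||l low_l e] := @unramified_constant F p p_gt0 [:: ('X, norm_poly x)].
- by rewrite /= /nzpair /= X0 N0.
- by move=> P P_irr P_mon; exact: norm_poly_unramified.
have ker (b : F) (f : {poly F}) : (horner_eval b f == 0) = ('X - b%:P %| f).
  by rewrite dvdp_XsubCl.
pose sp (b : F) := specialize (irredp_XsubC b) (horner_eval b) s.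
have spP b : poly_symbol p (sp b).
  by apply: specialize_poly_symbol => //; exact: ker.
have sp_const b : psum (sp b) l = psum (sp 1) l.
  have res_const (d k : F) : k != 0 ->
      val (res (irredp_XsubC d) (horner_eval d) k%:P) = k.
    move=> k0; have nd : ~~ ('X - d%:P %| k%:P) by rewrite -ker /horner_eval hornerC.
    by rewrite (res_ndvd _ (ker d) nd) /= /horner_eval hornerC.
  rewrite /psum; apply: eq_big_seq => -[f g] /(allP low_l)/and3P[/andP[/=]].
  move=> f0 g0 /size1_polyC fE /size1_polyC gE.
  move: f0 g0; rewrite {}fE {}gE !polyC_eq0 => f0 g0.
  by rewrite /sp /specialize /=; congr (s _ _); apply: val_inj; rewrite /= !res_const.
have := e _ _ (spP (val a)); rewrite sp_const -(e _ _ (spP 1)).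
rewrite !psum_cons !psum_nil !addr0 /= /sp /specialize.
have resX (d : F) : d != 0 -> val (res (irredp_XsubC d) (horner_eval d) 'X) = d.
  move=> d0; have nd : ~~ ('X - d%:P %| 'X) by rewrite -ker /horner_eval hornerX.
  by rewrite (res_ndvd _ (ker d) nd) /= /horner_eval hornerX.
have -> : res (irredp_XsubC (1 : F)) (horner_eval (1 : F)) 'X = 0.
  by apply: val_inj; rewrite resX ?oner_neq0.
rewrite (st_0l sP).
have -> : res (irredp_XsubC (val a)) (horner_eval (val a)) 'X = a.
  by apply: val_inj; rewrite resX // (valP a).
suff -> : res (irredp_XsubC (val a)) (horner_eval (val a)) (norm_poly x) = c by [].
have nd : ~~ ('X - (val a)%:P %| norm_poly x).
  by rewrite -ker /horner_eval norm_poly_horner -cE (valP c).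
apply: val_inj; rewrite (res_ndvd _ (ker _) nd) /= /horner_eval.
by rewrite norm_poly_horner -cE.
Qed.

(** The entry [c] is the norm of $\theta$. For $p = 2$ this is $\{a, -a\} = 0$; for odd $p$, $\{a,
    a\}$ is killed by both $2$ and $p$. *)
Lemma symbol_signed_self a c : val c = (-1) ^+ p.-1 * val a -> s a c = 0.
Proof.
rewrite -signr_odd; case: (boolP (odd p.-1)) => odd_p cE.
  have -> : c = foppr a by apply: val_inj; rewrite cE expr1 mulN1r.
  exact: st_foppr.
have -> : c = a by apply: val_inj; rewrite cE expr0 mul1r.
have saa2 : s a a + s a a = 0.
  by rewrite (st_diag sP) -(st_Dr sP) foppr0D0 (st_0r sP).
have := B_torsion (s a a); rewrite -(prednK p_gt0) mulrS.
rewrite -(odd_double_half p.-1) (negPf odd_p) add0n -muln2 mulnC mulrnA mulr2n.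
by rewrite saa2 mul0rn addr0.
Qed.

Lemma symbol_norm a c x : val c = normf p (val a) x -> s a c = 0.
Proof.
(* Truncating beyond the first [p] coefficients provides the condition [y p = 0] of [normf_shift]
   and a bound for the induction. *)
have [y y_ge yx] : exists2 y : nat -> F,
    forall k, (p <= k)%N -> y k = 0 & forall k, (k < p)%N -> y k = x k.
  by exists (fun k => if (k < p)%N then x k else 0) => k; rewrite ltnNge => ->.
rewrite -(@eq_normf _ p (val a) y x) //.
have [n le_pn] : exists n, forall k, (n <= k)%N -> y k = 0 by exists p.
move: y y_ge le_pn c {x yx}.
(* Multiplying [theta ^ i] out of the element until its constant term is
   nonzero. *)
elim: n => [|n IH] y y_ge y_n c cE.
  have /eqP[] := valP c; rewrite cE -(@eq_normf _ _ _ (fun=> 0)); last by move=> k _; rewrite y_n.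
  rewrite /normf; have -> : normmx p (val a) (fun=> 0) = 0.
    by apply/matrixP => i j; rewrite !mxE mulr0; case: ifP.
  by rewrite -(scale0r 0) detZ expr0n eqn0Ngt p_gt0 mul0r.
have [y0|] := eqVneq (y 0%N) 0; last by move=> y0; exact: symbol_norm_poly cE.
have pE := prednK p_gt0; have yp : y p.-1.+1 = 0 by rewrite pE y_ge.
move: cE; rewrite -{1}pE (normf_shift _ y0 yp) pE => cE.
have : val c != 0 := valP c; rewrite cE mulf_eq0 negb_or => /andP[d0 c'0].
pose d : Funits F := funit d0; pose c' : Funits F := funit c'0.
have -> : c = d + c' by apply: val_inj; rewrite cE.
rewrite (st_Dr sP) symbol_signed_self // add0r.
apply: (IH (fun k => y k.+1)) => // k le_k; first by rewrite y_ge // leqW.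
by rewrite y_n.
Qed.

End SymbolNorm.

(** * Eliminating a symbol *)

(** The variables are read in blocks of [p], the first block entering the outermost norm. *)
Fixpoint chain_form (R : comNzRingType) p (ab : seq (R * R)) (c : R)
    (x : nat -> R) : R :=
  if ab is (a, b) :: ab' then
    a * chain_form p ab' c (fun k => x (p + k)%N) + b * normf p a x
  else c ^+ p.

Lemma chain_form_morph (R S : comNzRingType) (f : {rmorphism R -> S}) p ab c x :
  f (chain_form p ab c x) =
  chain_form p [seq (f y.1, f y.2) | y <- ab] (f c) (f \o x).
Proof.
elim: ab x => [|[a b] ab IH] x /=; first exact: rmorphXn.
by rewrite rmorphD !rmorphM IH normf_morph.
Qed.

(** * Homogeneity of the norm and chain forms *)

Section Homogeneous.
Context (n : nat) (F : fieldType) (p : nat).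

Lemma mpolyC_mul_dhomog d (a : F) (f : {mpoly F[n]}) :
  f \is d.-homog -> a%:MP * f \is d.-homog.
Proof. by move=> fd; rewrite mul_mpolyC; exact: dhomogZ. Qed.

Lemma prod_dhomog (I : Type) (r : seq I) (f : I -> {mpoly F[n]}) :
  (forall i, f i \is 1.-homog) -> \prod_(i <- r) f i \is (size r).-homog.
Proof.
move=> f1; elim: r => [|i r IH]; first by rewrite big_nil dhomog1.
by rewrite big_cons /= -add1n; exact: dhomogM.
Qed.

Lemma normf_dhomog (a : F) (x : nat -> {mpoly F[n]}) :
  (forall k, x k \is 1.-homog) -> normf p a%:MP x \is p.-homog.
Proof.
move=> x1; apply: rpred_sum => s _; rewrite mulr_sign.
have szI : size (index_enum 'I_p) = p.
  by rewrite -sum1_size sum_nat_const card_ord muln1.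
rewrite fun_if; have : \prod_(i : 'I_p) normmx p a%:MP x i (perm.fun_of_perm s i)
    \is p.-homog.
  rewrite -[X in X.-homog]szI; apply: prod_dhomog => i; rewrite mxE; case: ifP => // _.
  exact: mpolyC_mul_dhomog.
by case: ifP => // _; rewrite dhomogN.
Qed.

Lemma chain_form_dhomog (ab : seq (F * F)) (c : {mpoly F[n]})
    (x : nat -> {mpoly F[n]}) : c \is 1.-homog -> (forall k, x k \is 1.-homog) ->
  chain_form p [seq (y.1%:MP, y.2%:MP) | y <- ab] c x \is p.-homog.
Proof.
move=> c1; elim: ab x => [|[a b] ab IH] x x1 /=.
  by rewrite -[X in X.-homog]mul1n; exact: dhomogMn.
by apply: rpredD; apply: mpolyC_mul_dhomog; [exact: IH | exact: normf_dhomog].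
Qed.

End Homogeneous.

(** * Rewriting sums of symbols along zeros and values of the chain form *)

Section Chain.
Context (F : fieldType) (p : nat) (p_pr : prime p).
Context (B : zmodType) (s : Funits F -> Funits F -> B).
Hypothesis sP : steinberg_symbol s.
Hypothesis B_torsion : forall y : B, y *+ p = 0.
Implicit Types (l : seq (Funits F * Funits F)) (x : nat -> F) (a b c z : Funits F).

Let p_gt0 : (0 < p)%N := prime_gt0 p_pr.

Definition total l : B := \sum_(ab <- l) s ab.1 ab.2.

Definition short t (y : B) := exists2 l, (size l <= t)%N & y = total l.

Lemma short_cons t y a b : short t y -> short t.+1 (s a b + y).
Proof.
by move=> [l le_l ->]; exists ((a, b) :: l); rewrite // /total big_cons.
Qed.

Lemma st_pth_power a b (v : F) : val a = v ^+ p -> s a b = 0.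
Proof.
move=> av; have v0 : v != 0.
  by apply: contraNneq (valP a) => v0; rewrite av v0 expr0n eqn0Ngt p_gt0.
have -> : a = funit v0 *+ p by apply: val_inj; rewrite Funits_valMn.
by rewrite (st_Mnl sP) B_torsion.
Qed.

Definition vals l : seq (F * F) := [seq (val ab.1, val ab.2) | ab <- l].

(** A symbol with entry [z] is absorbed without lengthening the sum. Induct on the nesting, $z = a q
    + b N$; the innermost value $c^p$ contributes nothing modulo $p$. In each case the first symbol
    and $\{z, h\}$ become one new symbol and possibly one with entry $q$, left to the induction. *)
Lemma chain_form_neq0 l (c : F) x z h : val z = chain_form p (vals l) c x ->
  short (size l) (total l + s z h).
Proof.
elim: l x z h => [|[a b] l IH] x z h zE.
  by exists [::]; rewrite // /total big_nil (st_pth_power _ zE) addr0.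
rewrite /total big_cons -/(total l) /=.
pose q := chain_form p (vals l) c (fun k => x (p + k)%N).
pose N := normf p (val a) x.
have [N0|N_neq0] := eqVneq N 0.
  have q_neq0 : q != 0.
    have z0 : val z != 0 := valP z.
    by apply: contraNneq z0 => q0; rewrite zE /= -/q -/N N0 q0 !mulr0 addr0.
  have -> : z = a + funit q_neq0.
    by apply: val_inj; rewrite zE /= -/q -/N N0 mulr0 addr0.
  have := short_cons a (b + h) (IH _ (funit q_neq0) h erefl).
  by rewrite (st_Dl sP) (st_Dr sP); congr short; zmod.
pose b' := b + funit N_neq0.
have sab : s a b = s a b'.
  rewrite (st_Dr sP).
  by rewrite (@symbol_norm _ _ p_pr _ _ sP B_torsion a (funit N_neq0) x) ?addr0.
have [q0|q_neq0] := eqVneq q 0.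
  have zb : z = b' by apply: val_inj; rewrite zE /= -/q q0 mulr0 add0r.
  have := @short_cons (size l) (total l) z (h - a).
  have -> : s z (h - a) + total l = s a b + total l + s z h.
    by rewrite sab -zb (st_Dr sP) (st_Nr sP) (st_anti sP z a); zmod.
  by apply; exists l.
(* With $u = a q$ and $b' = b N$, the Steinberg relation for $u + b' = z$ gives $\{a, b'\} = \{z,
   b'/(u z)\} + \{q, 1/b'\}$; the second symbol is absorbed by the inner sum. *)
pose u := a + funit q_neq0.
have := st_add sP (a := u) (b := b') (c := z); rewrite zE => /(_ erefl) E.
have := short_cons z (b' - u - z + h) (IH _ (funit q_neq0) (- b') erefl).
congr short; apply: (zmod_lin (esym E)).
have sub : s u b' = s a b' + s (funit q_neq0) b' by rewrite (st_Dl sP).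
rewrite sab; move: sub; clearbody u b'; move=> sub.
rewrite !(st_Dr sP) !(st_Nr sP) (st_anti sP z u) sub; zmod.
Qed.

(** If $N \neq 0$, then $a q = -b N$ turns the first symbol into one with entry $q$, which
    [chain_form_neq0] absorbs. If $N = 0$, the inner form vanishes as well. *)
Lemma chain_form_eq0 l (c : F) x : chain_form p (vals l) c x = 0 ->
  c != 0 \/ (exists2 k, (k < p * size l)%N & x k != 0) ->
  (0 < size l)%N /\ short (size l).-1 (total l).
Proof.
elim: l x => [|[a b] l IH] x /= zE nz.
  case: nz => [|[k]]; last by rewrite muln0.
  by move/eqP: zE; rewrite expf_eq0 => /andP[_ ->].
split=> //; rewrite /total big_cons -/(total l) /=.
pose q := chain_form p (vals l) c (fun k => x (p + k)%N).
pose N := normf p (val a) x.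
have [N0|N_neq0] := eqVneq N 0.
  have q0 : q = 0.
    move/eqP: zE; rewrite -/q -/N N0 mulr0 addr0 mulf_eq0.
    by rewrite (negPf (valP a)) => /eqP.
  (* Either the inner zero is nontrivial and induction applies, or a nonzero coordinate lies in the
     outer block; then [a] is a $p$-th power and its symbol vanishes. *)
  have [nz'|nz'] :=
      pselect (c != 0 \/ (exists2 k, (k < p * size l)%N & x (p + k)%N != 0)).
    have [l_gt0] := IH _ q0 nz'; rewrite -{2}(prednK l_gt0).
    exact: short_cons.
  have [k lt_kp xk] : exists2 k, (k < p)%N & x k != 0.
    case: nz => [c0|[k lt_k xk]]; first by case: nz'; left.
    have [lt_kp|le_pk] := ltnP k p; first by exists k.
    case: nz'; right; exists (k - p)%N; last by rewrite subnKC.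
    by rewrite ltn_subLR // -mulnS.
  have [v av] := normf_eq0 p_pr lt_kp xk N0.
  by rewrite (st_pth_power _ av) add0r; exists l.
pose b' := b + funit N_neq0.
have q_neq0 : q != 0.
  apply: contraNneq (valP b') => q0; move/eqP: zE.
  by rewrite -/q q0 mulr0 add0r.
have uE : a + funit q_neq0 = foppr b'.
  by apply: val_inj; apply/eqP; rewrite /= -addr_eq0 zE.
have -> : s a b = s a b'.
  rewrite (st_Dr sP).
  by rewrite (@symbol_norm _ _ p_pr _ _ sP B_torsion a (funit N_neq0) x) ?addr0.
(* From $\{a q, b'\} = \{-b', b'\} = 0$. *)
have -> : s a b' = s (funit q_neq0) (- b').
  have : s (a + funit q_neq0) b' = 0 by rewrite uE (st_anti sP) (st_foppr sP) oppr0.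
  by rewrite (st_Dl sP) (st_Nr sP) => /eqP; rewrite addr_eq0 => /eqP.
by rewrite addrC; exact: chain_form_neq0.
Qed.

(** Add symbols one by one, shortening whenever the length reaches [t]. *)
Lemma short_total t l : (0 < t)%N ->
  (forall l', size l' = t -> short t.-1 (total l')) -> short t.-1 (total l).
Proof.
move=> t_gt0 red; elim: l => [|[a b] l [l' le_l' lE]]; first by exists [::].
have -> : total ((a, b) :: l) = total ((a, b) :: l').
  by rewrite /total !big_cons -/(total l) lE.
move: le_l'; rewrite leq_eqVlt => /orP[/eqP sz_l'|lt_l']; last by exists ((a, b) :: l').
by apply: red; rewrite /= sz_l' prednK.
Qed.

Lemma C_field_short m l : (0 < m)%N -> C_field m F ->
  short (p ^ (m - 1) - 1) (total l).
Proof.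
move=> m_gt0 F_Cm; rewrite subn1; apply: short_total => [|{}l sz_l].
  by rewrite expn_gt0 p_gt0.
pose N := (p * size l).+1.
(* Variable $0$ is the innermost [c] and variable $k + 1$ is [x k], which makes $p \cdot p^{m-1} + 1
   = p^m + 1$ variables. *)
pose c : {mpoly F[N]} := 'X_ord0.
pose x (k : nat) : {mpoly F[N]} := 'X_(inord k.+1).
pose f := chain_form p [seq (y.1%:MP, y.2%:MP) | y <- vals l] c x.
have X_homog (i : 'I_N) : ('X_i : {mpoly F[N]}) \is 1.-homog.
  by rewrite dhomogX /= mdeg1.
have [||v [i vi] fv] := F_Cm p N f p_gt0.
- by rewrite /N sz_l -expnS ltnS subn1 prednK.
- by apply: chain_form_dhomog => [|k]; exact: X_homog.
have fE : chain_form p (vals l) (v ord0) (fun k => v (inord k.+1)) = 0.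
  rewrite -[RHS]fv -[RHS]/(meval v f) chain_form_morph /= mevalXU.
  rewrite -map_comp (eq_map (g := id)) ?map_id; last first.
    by move=> [a b] /=; rewrite !mevalC.
  congr chain_form; apply: funext => k /=.
  by rewrite mevalXU.
rewrite -sz_l; apply: (chain_form_eq0 fE _).2.
have [i0|i_neq0] := eqVneq i ord0; first by left; rewrite -i0.
right; exists i.-1.
  by rewrite -ltnS prednK ?lt0n // ltn_ord.
by rewrite prednK ?lt0n // inord_val.
Qed.

End Chain.

(** * From $p$ to $p^k$ *)

Lemma symbol_steinberg_symbol (F : fieldType) n : steinberg_symbol (@symbol F n).
Proof.
split; [exact: symbolDl | exact: symbolDr | exact: symbol_steinberg].
Qed.

(** Each step writes the remainder as [t] symbols plus a multiple of [p]; the factor $p^k$ in front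
    of these symbols moves into their first entries. Working in $K_2$ itself allows the remainder to
    be divided again. *)
Lemma milnorK2_filtration (F : fieldType) p t k (xi : milnorK2 F) :
  (forall y : milnorK2_mod F p, short (@symbol F p) t y) ->
  exists (l : seq (Funits F * Funits F)) (eta : milnorK2 F),
    (size l <= k * t)%N /\ xi = \sum_(ab <- l) k2 ab.1 ab.2 + eta *+ p ^ k.
Proof.
move=> short_mod; elim: k => [|k [l [eta [le_l ->]]]].
  by exists [::], xi; rewrite big_nil add0r.
have [l' le_l' lE'] := short_mod (\pi_(milnorK2_mod F p)%qT eta).
have /multiplesP[eta' E] : eta - \sum_(ab <- l') k2 ab.1 ab.2 \in multiples p.
  by apply/quot_pi_eq0P; rewrite raddfB /= lE' raddf_sum subrr.
exists (l ++ [seq (ab.1 *+ p ^ k, ab.2) | ab <- l']), eta'; split.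
  by rewrite size_cat size_map mulSn addnC leq_add.
rewrite big_cat big_map -addrA; congr (_ + _).
under eq_bigr do rewrite /= k2_Mnl.
by rewrite sumrMnl expnS mulrnA -E mulrnBl addrC subrK.
Qed.

Theorem theorem8p2 (p k m : nat) (F : fieldType)
    (p_prime : prime p) (k_gt0 : (1 <= k)%N) (m_gt0 : (1 <= m)%N)
    (F_Cm : C_field m F) (alpha : milnorK2_mod F (p ^ k)) :
  exists s : seq (milnorK2_mod F (p ^ k)),
    [/\ (size s <= k * (p ^ (m - 1) - 1))%N,
        (forall x, x \in s -> is_symbol x)
      & alpha = \sum_(x <- s) x].
Proof.
have short_mod (y : milnorK2_mod F p) : short (@symbol F p) (p ^ (m - 1) - 1) y.
  have [l ->] := symbol_generation y.
  exact: (C_field_short p_prime (symbol_steinberg_symbol F p)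
            (@milnorK2_mod_torsion F p) l m_gt0 F_Cm).
have [l [eta [le_l E]]] := milnorK2_filtration k (repr alpha) short_mod.
exists [seq symbol (p ^ k) ab.1 ab.2 | ab <- l]; split.
- by rewrite size_map.
- by move=> _ /mapP[ab _ ->]; exists ab.1, ab.2.
- rewrite -[alpha]reprK E raddfD raddfMn /= milnorK2_mod_torsion addr0.
  by rewrite raddf_sum big_map.
Qed.
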